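(* There exist absolute constants $c', c_1, c_2 > 0$ such that the following holds. Let $1\le p\le\infty$ and let $n, N$ be positive integers with $n\le N\le e^{c'n}$. Let $X_1,\dots,X_N$ be independent random vectors uniformly distributed in $D_p^n$ and let $K_N=\mathrm{conv}\{\pm X_1,\dots,\pm X_N\}$. Then for all $j=1,\dots,n$, $$c_1(\log N)^{1/p}\ \le\ \mathbb{E}\,h_{K_N}(e_j)=\mathbb{E}\max_{1\le i\le N}|\langle X_i,e_j\rangle|\ \le\ c_2(\log N)^{1/p}.$$
   Context: $B_p^n=\{x\in\mathbb{R}^n:\|x\|_p\le 1\}$ is the unit ball of $\ell_p^n$, $|\cdot|$ denotes Lebesgue measure (volume), and $D_p^n=B_p^n/|B_p^n|^{1/n}$ is the dilate of $B_p^n$ of volume $1$. $e_1,\dots,e_n$ is the canonical basis of $\mathbb{R}^n$ and $\langle\cdot,\cdot\rangle$ the standard scalar product. The support function of a compact convex set $K$ is $h_K(\theta)=\max\{\langle x,\theta\rangle:x\in K\}$. For $p=\infty$ we use $1/p=0$. ''Absolute constant'' means independent of $n,N,p,j$.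
   Formalization: The upper bound is asserted only when N > 1 or p = ∞, because for n = N = 1 and p < ∞ it would read E|X_1| = 1/4 ≤ 0; the lower bound and the equality are kept in all cases. *)

(* Defs.v *)
From HB Require Import structures.
From mathcomp Require Import all_boot all_order all_algebra.
From mathcomp Require Import all_classical all_reals all_analysis.
From mathcomp Require Import measurable_realfun.

Set Implicit Arguments.
Unset Strict Implicit.
Unset Printing Implicit Defensive.

Import Order.TTheory GRing.Theory Num.Theory.
Import numFieldNormedType.Exports.

Local Open Scope classical_set_scope.
Local Open Scope ring_scope.

(* The Borel sigma-algebra of R^n, presented as the product sigma-algebra:
   the one generated by the coordinate maps. *)
Section measurable_rV.
Context {R : realType} {n : nat}.

Let coor (i : 'I_n) (x : 'rV[R]_n) : R := x ord0 i.

Let rV_set0 : g_sigma_preimage coor set0.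
Proof. exact: sigma_algebra0. Qed.

Let rV_setC A : g_sigma_preimage coor A -> g_sigma_preimage coor (~` A).
Proof. exact: sigma_algebraC. Qed.

Let rV_bigcup (F : (set 'rV[R]_n)^nat) :
  (forall i, g_sigma_preimage coor (F i)) ->
  g_sigma_preimage coor (\bigcup_i F i).
Proof. exact: sigma_algebra_bigcup. Qed.

HB.instance Definition _ := @isMeasurable.Build default_measure_display
  'rV[R]_n (g_sigma_preimage coor) rV_set0 rV_setC rV_bigcup.

End measurable_rV.

(* n-dimensional Lebesgue measure, as the iterated product
   lambda^(n+1) = lambda \x lambda^n with lambda^0 the Dirac mass on the
   one-point space R^0. It is only meaningful on measurable sets; see
   [volume_box] for its value on measurable boxes. *)
Fixpoint volume {R : realType} (n : nat) : set 'rV[R]_n -> \bar R :=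
  match n with
  | 0 => fun A => \d_(0 : 'rV[R]_0) A
  | m.+1 => fun A => (\int[lebesgue_measure]_t
      volume [set x : 'rV[R]_m | A (row_mx (t%:M : 'rV[R]_1) x)])%E
  end.

Section volume_box.

Lemma row_mx_lift0 (R : realType) n (t : R) (x : 'rV[R]_n) i :
  (row_mx (t%:M : 'rV_1) x : 'rV_n.+1) ord0 (lift ord0 i) = x ord0 i.
Proof.
by rewrite -(row_mxEr t%:M x); congr (row_mx _ _ _ _); apply: val_inj.
Qed.

Lemma row_mx_ord0 (R : realType) n (t : R) (x : 'rV[R]_n) :
  (row_mx (t%:M : 'rV_1) x : 'rV_n.+1) ord0 ord0 = t.
Proof.
rewrite -[RHS]mulr1n -[LHS](_ : (row_mx (t%:M : 'rV_1) x) ord0 (lshift n ord0) = _).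
  by rewrite row_mxEl mxE.
by congr (row_mx _ _ _ _); apply: val_inj.
Qed.

Lemma volume0 (R : realType) n : volume (set0 : set 'rV[R]_n) = 0%E.
Proof.
elim: n => [|n IH] /=; first by rewrite diracE in_set0.
by under eq_integral do rewrite IH; rewrite integral0.
Qed.

Lemma volume_box (R : realType) n (B : 'I_n -> set R) :
  (forall i, measurable (B i)) ->
  volume [set x : 'rV[R]_n | forall i, B i (x ord0 i)] =
  (\prod_(i < n) lebesgue_measure (B i))%E.
Proof.
elim: n B => [|n IH] B mB.
  by rewrite big_ord0 /= diracE mem_set//=; case.
rewrite big_ord_recl /= -(IH (fun i => B (lift ord0 i))) //.
set v := volume _.
have v0 : (0 <= v)%E.
  rewrite /v (IH (fun i => B (lift ord0 i)))//.
  by elim/big_ind : _ => // x y x0 y0; exact: mule_ge0.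
transitivity (\int[lebesgue_measure]_(t in [set: measurableTypeR R])
    ((\1_(B ord0) t)%:E * v))%E.
  apply: eq_integral => t _; rewrite indicE.
  have [/set_mem tB|tB] := boolP (t \in B ord0).
  - rewrite mul1e; congr volume; apply/seteqP; split => x /= h i.
    + by have := h (lift ord0 i); rewrite row_mx_lift0.
    + by case: (unliftP ord0 i) => [k ->|->]; rewrite ?row_mx_lift0 ?row_mx_ord0.
  - rewrite mul0e -(volume0 R n); congr volume.
    apply/seteqP; split => x //= /(_ ord0); rewrite row_mx_ord0 => ?.
    by move/negP: tB; apply; rewrite inE.
rewrite ge0_integralZr//.
- congr (_ * _)%E.
  have := @integral_indic _ _ _ (@lebesgue_measure R) setT measurableT
    (B ord0) (mB ord0).
  by rewrite setIT => h; exact: h.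
- have h : measurable_fun [set: R] (EFin \o (\1_(B ord0) : R -> R)).
    by apply: measurableT_comp => //; exact: measurable_indic.
  exact: h.
Qed.

End volume_box.

Section geometry.
Context {R : realType} {n : nat}.
Implicit Types (p : \bar R) (x y theta : 'rV[R]_n) (A K : set 'rV[R]_n).

Definition dotprod x y : R := \sum_(i < n) x ord0 i * y ord0 i.

(* Only used for 1 <= p <= +oo. *)
Definition lpnorm p x : R :=
  match p with
  | r%:E => (\sum_(i < n) `|x ord0 i| `^ r) `^ r^-1
  | _ => \big[Num.max/0]_(i < n) `|x ord0 i|
  end.

Definition lpball p : set 'rV[R]_n := [set x | lpnorm p x <= 1].

Definition normalized_lpball p : set 'rV[R]_n :=
  [set (fine (volume (lpball p)) `^ n%:R^-1)^-1 *: x | x in lpball p].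

Definition convex_hull A : set 'rV[R]_n := smallest (@convex_set R 'rV[R]_n) A.

(* For K nonempty and compact the supremum is a maximum. *)
Definition support_function K theta : R := sup [set dotprod x theta | x in K].

Definition symmetric_hull N (x : 'I_N -> 'rV[R]_n) : set 'rV[R]_n :=
  convex_hull (range x `|` range (fun i => - x i)).

End geometry.

Definition exponent_inv {R : realType} (p : \bar R) : R :=
  if p is r%:E then r^-1 else 0.

Section random_vectors.
Context {R : realType} {d d'} {T : measurableType d} {E : measurableType d'}.
Local Open Scope ereal_scope.

Definition mutually_independent (P : probability T R) (I : finType)
    (X : I -> {RV P >-> E}) : Prop :=
  forall (J : {set I}) (A : I -> set E), (forall i, measurable (A i)) ->
    P (\bigcap_(i in [set` J]) (X i @^-1` A i)) =
    \prod_(i in J) P (X i @^-1` A i).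

End random_vectors.

Definition uniformly_distributed {R : realType} {d} {T : measurableType d} {n}
    (P : probability T R) (K : set 'rV[R]_n) (X : {RV P >-> 'rV[R]_n}) : Prop :=
  forall A : set 'rV[R]_n, measurable A ->
    distribution P X A = (volume (A `&` K) / volume K)%E.

(* Main.v *)
Require Import Defs.
From mathcomp Require Import all_boot all_order all_algebra.
From mathcomp Require Import all_classical all_reals all_analysis.
From mathcomp Require Import measurable_realfun.
From mathcomp Require Import ring lra.
Import Order.TTheory GRing.Theory Num.Theory.
Import numFieldNormedType.Exports.
Local Open Scope classical_set_scope.
Local Open Scope ring_scope.

(**
A linear functional is largest on a convex hull at one of the generating
points, so the support function of the hull of the +-X_i at e_j is the maximum
of the |<X_i, e_j>|, and only the law of one coordinate of a uniform point of
the ball of volume one matters.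

Let p be finite and let r be the n-th root of the volume of the unit ball of
l_p^n, so that the ball of volume one is {sum_i (r |x_i|)^p <= 1}. Slicing by
hyperplanes and the homogeneity of volume ([volume_pball], [volume_pball_coord])
show that a coordinate has a density proportional to
(1 - (r |u|)^p)_+^((n-1)/p). Moreover r is of order n^(-1/p), with constants
free of p: the inscribed cube bounds it below, and the exponential Chebyshev
inequality 1_{S <= 1} <= exp (b^p (1 - S)), S = sum_i |x_i|^p, bounds it above
([volume_radius_ge], [volume_radius_le]). Hence the density decays like
exp (- (n/p) (r |u|)^p), where n (r |u|)^p lies between two powers (c |u|)^p
with c absolute, and with L = log N there are absolute constants c, k for which
- a coordinate exceeds 3 e L^(1/p) with probability at most e n N^(-3)
  ([uniform_coord_tail_le]);
- it exceeds c L^(1/p) with probability at least k / N, provided L <= n / 2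
  ([uniform_coord_tail_ge]).

By the union bound the maximum exceeds 3 e L^(1/p) with probability at most
e n N^(-2), and it almost surely stays below 1 / r <= n; so this event contributes at most
e n^2 N^(-2) <= e to the expectation, which is absorbed because L^(1/p) >= 1/2.
By independence all N variables stay below c L^(1/p) with probability at most
exp (- k), which gives the lower bound.

For p = +oo the ball of volume one is the cube [-1/2, 1/2]^n and both sides are
constants. If N = 1 then log N = 0 and, for finite p, the lower bound is
nonnegativity.
*)

Set Implicit Arguments.
Unset Strict Implicit.
Unset Printing Implicit Defensive.

(** * Measurability and integration on the line *)

Lemma measurable_superlevel d (T : measurableType d) (R : realType)
    (t : R) (f : T -> R) :
  measurable_fun setT f -> measurable [set w | t <= f w].
Proof.
move=> mf; rewrite (_ : mkset _ = f @^-1` `[t, +oo[%classic); last first.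
  by apply/seteqP; split => w /=; rewrite in_itv/= andbT.
by rewrite -[X in measurable X]setTI; exact: mf.
Qed.

Lemma measurable_strict_superlevel d (T : measurableType d) (R : realType)
    (t : R) (f : T -> R) :
  measurable_fun setT f -> measurable [set w | t < f w].
Proof.
move=> mf; rewrite (_ : mkset _ = f @^-1` `]t, +oo[%classic); last first.
  by apply/seteqP; split => w /=; rewrite in_itv/= andbT.
by rewrite -[X in measurable X]setTI; exact: mf.
Qed.

Lemma lebesgue_measure_cc (R : realType) (a b : R) : a <= b ->
  lebesgue_measure (`[a, b]%classic : set R) = (b - a)%:E.
Proof.
move=> ab; rewrite lebesgue_measure_itv/= lte_fin.
by case: ltgtP ab => // -> _; rewrite subrr.
Qed.

(** The image of Lebesgue measure under the dilation of ratio c, multiplied by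
    c, agrees with Lebesgue measure on intervals. *)
Lemma ge0_integral_scale (R : realType) (f : R -> \bar R) (c : R) : 0 < c ->
  measurable_fun [set: R] f -> (forall x, 0 <= f x)%E ->
  (\int[lebesgue_measure]_x f (c * x)%R =
   (c^-1)%:E * \int[lebesgue_measure]_x f x)%E.
Proof.
move=> c0 mf f0.
have mc : measurable_fun [set: measurableTypeR R]
    ( *%R c : measurableTypeR R -> measurableTypeR R).
  exact: mulrl_measurable.
pose phi := *%R c : measurableTypeR R -> measurableTypeR R.
have c0' : 0 <= c by exact: ltW.
pose m0 : {measure set (measurableTypeR R) -> \bar R} :=
  measure_function_pushforward__canonical__measure_function_Measure
    (@lebesgue_measure R) mc.
pose mu' := mscale (NngNum c0') m0.
have key A : measurable A -> lebesgue_measure A = mu' A.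
  apply: (@lebesgue_measure_unique R mu') => _ [[a b]] _ <-.
  have phiE : phi @^-1` `]a, b] = `]a / c, b / c]%classic.
    apply/seteqP; split => x /=; rewrite !in_itv /= ltr_pdivrMr// ler_pdivlMr//;
      by rewrite ![x * c]mulrC.
  change (lebesgue_measure `]a, b] =
    (c%:E * lebesgue_measure (phi @^-1` `]a, b]))%E).
  rewrite phiE.
  rewrite !lebesgue_measure_itv /= !lte_fin ltr_pM2r ?invr_gt0//.
  case: ifPn => _; last by rewrite mule0.
  rewrite -!EFinB -EFinM; congr EFin; field; exact: lt0r_neq0.
have -> : (\int[lebesgue_measure]_x f x = \int[mu']_x f x)%E.
  by apply: eq_measure_integral => A mA _; exact: key.
rewrite ge0_integral_mscale//=.
by rewrite muleA -EFinM mulVf ?lt0r_neq0// mul1e ge0_integral_pushforward.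
Qed.

Lemma ge0_integral_opp (R : realType) (f : R -> \bar R) :
  measurable_fun [set: R] f -> (forall x, 0 <= f x)%E ->
  (\int[lebesgue_measure]_x f (- x)%R = \int[lebesgue_measure]_x f x)%E.
Proof.
move=> mf f0.
have mN : measurable_fun [set: measurableTypeR R]
    (-%R : measurableTypeR R -> measurableTypeR R).
  exact: oppr_measurable.
pose m0 : {measure set (measurableTypeR R) -> \bar R} :=
  measure_function_pushforward__canonical__measure_function_Measure
    (@lebesgue_measure R) mN.
have -> : (\int[lebesgue_measure]_x f x = \int[m0]_x f x)%E.
  by apply: eq_measure_integral => A mA _; exact/esym/lebesgue_measureN.
by rewrite ge0_integral_pushforward.
Qed.

Lemma ge0_integral_realZl (R : realType) (f : R -> R) (c : R) : 0 <= c ->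
  measurable_fun [set: R] f -> (forall t, 0 <= f t) ->
  (\int[lebesgue_measure]_t (c * f t)%:E =
   c%:E * \int[lebesgue_measure]_t (f t)%:E)%E.
Proof.
move=> c0 mf f0.
have /measurable_EFinP mEf := mf.
have f0' t : [set: R] t -> (0 <= (f t)%:E)%E by rewrite lee_fin.
exact: (ge0_integralZl_EFin (@lebesgue_measure R) measurableT f0' mEf c0).
Qed.

Section interval_bounds.
Context {R : realType}.
Implicit Types (f : R -> R) (a b c : R).

Let integral_cst_itv a b c : a <= b -> 0 <= c ->
  (\int[lebesgue_measure]_t (c * \1_(`[a, b]%classic) t)%:E = (c * (b - a))%:E)%E.
Proof.
move=> ab c0; rewrite ge0_integral_realZl//.
rewrite integral_indic// setIT EFinM; congr (_ * _)%E.
exact: lebesgue_measure_cc.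
Qed.

Lemma integral_le_itv f a b c : a <= b -> 0 <= c ->
  measurable_fun [set: R] f -> (forall t, 0 <= f t) ->
  (forall t, a <= t <= b -> f t <= c) -> (forall t, ~~ (a <= t <= b) -> f t = 0) ->
  (\int[lebesgue_measure]_t (f t)%:E <= (c * (b - a))%:E)%E.
Proof.
move=> ab c0 mf f0 fc fn; rewrite -integral_cst_itv//.
apply: ge0_le_integral => //=.
- by move=> t _; rewrite lee_fin.
- exact/measurable_EFinP.
- by apply/measurable_EFinP/measurable_funM => //; exact: measurable_indic.
move=> t _; rewrite lee_fin indicE.
have [tab|tab] := boolP (a <= t <= b); first by rewrite mem_set// mulr1 fc.
by rewrite fn// mulr_ge0.
Qed.

Lemma integral_ge_itv f a b c : a <= b -> 0 <= c ->
  measurable_fun [set: R] f -> (forall t, 0 <= f t) ->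
  (forall t, a <= t <= b -> c <= f t) ->
  ((c * (b - a))%:E <= \int[lebesgue_measure]_t (f t)%:E)%E.
Proof.
move=> ab c0 mf f0 fc; rewrite -integral_cst_itv//.
apply: ge0_le_integral => //=.
- by move=> t _; rewrite lee_fin mulr_ge0.
- by apply/measurable_EFinP/measurable_funM => //; exact: measurable_indic.
- exact/measurable_EFinP.
move=> t _; rewrite lee_fin indicE.
have [tab|tab] := boolP (a <= t <= b); first by rewrite mem_set// mulr1 fc.
by rewrite memNset ?mulr0//; exact/negP.
Qed.

End interval_bounds.

Lemma measurable_expR_powR (R : realType) (p b : R) :
  measurable_fun [set: R] (fun t : R => expR (- (b * `|t|) `^ p)).
Proof.
apply: measurableT_comp => //; apply: measurableT_comp => //.
have mb : measurable_fun [set: R] (fun t : R => b * `|t|) by exact: measurable_funM.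
exact: measurableT_comp (measurable_powR p) mb.
Qed.

(** For x >= 0 and p >= 1 one has x^p >= x - 1, so the integrand is at most e
    times the two-sided exponential of rate b; the bound is thus uniform in p. *)
Lemma integral_expR_powR_le (R : realType) (p b : R) : 1 <= p -> 0 < b ->
  (\int[lebesgue_measure]_u (expR (- (b * `|u|) `^ p))%:E <=
   (2 * expR 1 / b)%:E)%E.
Proof.
move=> p1 b0.
have mpdf := measurable_exponential_pdf b.
have pdf0 x : 0 <= exponential_pdf b x by apply: exponential_pdf_ge0; exact: ltW.
have mpdfN : measurable_fun [set: R] (fun u : R => exponential_pdf b (- u)).
  exact: (measurableT_comp mpdf (@oppr_measurable R setT)).
pose h (u : R) := exponential_pdf b u + exponential_pdf b (- u).
have mh : measurable_fun [set: R] h by exact: measurable_funD.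
have h0 u : 0 <= h u by rewrite addr_ge0.
have eb0 : 0 <= expR 1 / b by rewrite divr_ge0 ?expR_ge0// ltW.
apply: (@le_trans _ _ (\int[lebesgue_measure]_u (expR 1 / b * h u)%:E)%E).
  apply: ge0_le_integral => //=.
  - by apply/measurable_EFinP; exact: measurable_expR_powR.
  - by apply/measurable_EFinP; exact: measurable_funM.
  move=> u _; rewrite lee_fin /h.
  have main : expR (- (b * `|u|) `^ p) <= expR 1 / b * (b * expR (- b * `|u|)).
    rewrite mulrA divfK ?lt0r_neq0// -expRD ler_expR mulNr -lerBlDl.
    have y0 : 0 <= b * `|u| by rewrite mulr_ge0// ltW.
    have [y1|/ltW y1] := leP (b * `|u|) 1.
      by have := powR_ge0 (b * `|u|) p; lra.
    by have := le1r_powR y1 p1; lra.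
  apply: (le_trans main); apply: ler_wpM2l => //.
  have [u0|u0] := leP 0 u.
    by rewrite ger0_norm// exponential_pdfE// lerDl.
  by rewrite ltr0_norm// (@exponential_pdfE _ _ (- u)) ?lerDr// oppr_ge0 ltW.
rewrite ge0_integral_realZl// /h; under eq_integral do rewrite EFinD.
rewrite ge0_integralD//; last 4 first.
- by move=> u _; rewrite lee_fin.
- exact/measurable_EFinP.
- by move=> u _; rewrite lee_fin.
- exact/measurable_EFinP.
rewrite (ge0_integral_opp (f := fun u => (exponential_pdf b u)%:E))//;
  last exact/measurable_EFinP.
rewrite integral_exponential_pdf// -EFinD -EFinM lee_fin; lra.
Qed.

(** * Real powers *)

Lemma powRVK (R : realType) (p x : R) : p != 0 -> 0 <= x -> (x `^ p^-1) `^ p = x.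
Proof. by move=> p0 x0; rewrite -powRrM mulVf// powRr1. Qed.

Lemma powRKV (R : realType) (p x : R) : p != 0 -> 0 <= x -> (x `^ p) `^ p^-1 = x.
Proof. by move=> p0 x0; rewrite -powRrM mulfV// powRr1. Qed.

Lemma powR_invr (R : realType) (x q : R) : 0 <= x -> x^-1 `^ q = (x `^ q)^-1.
Proof. by move=> x0; rewrite -powR_inv1// powRAC powR_inv1// powR_ge0. Qed.

(** This follows from p <= e^p, and it is what keeps the constants below
    independent of p. *)
Lemma le_powRV_expR1 (R : realType) (p : R) : 0 < p -> p `^ p^-1 <= expR 1.
Proof.
move=> p0; have h : p <= expR p by have := expR_ge1Dx p; lra.
have pV0 : 0 <= p^-1 by rewrite invr_ge0 ltW.
apply: (le_trans (ge0_ler_powR pV0 _ _ h)); rewrite ?nnegrE ?expR_ge0 ?(ltW p0)//.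
by rewrite -expRM mulfV// lt0r_neq0.
Qed.

(** Applied to L = log N with N >= 2, it absorbs an additive constant into a
    multiple of L^(1/p). *)
Lemma half_le_powRV (R : realType) (p L : R) : 1 <= p -> 2^-1 <= L ->
  2^-1 <= L `^ p^-1.
Proof.
move=> p1 hL; have p0 : 0 < p by exact: lt_le_trans p1.
have pV0 : 0 <= p^-1 by rewrite invr_ge0 ltW.
have pV1 : p^-1 <= 1 by rewrite invf_le1.
have L0 : 0 < L by rewrite (lt_le_trans _ hL).
have [L1|/ltW L1] := leP L 1.
  by apply: (le_trans hL); apply: ger1_powR => //; rewrite L0.
have e1 : (1 : R) `^ p^-1 = 1 by rewrite powR1.
apply: (@le_trans _ _ 1); first lra.
by rewrite -[leLHS]e1 ge0_ler_powR// nnegrE ltW.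
Qed.

Section pos_powR.
Context {R : realType}.
Implicit Types a s : R.

(** The positive part power s_+^a. The factor is needed because x `^ a = 1 when
    x < 0; for a = 0 this is the indicator of the closed half-line, which is the
    volume in dimension 0. *)
Definition pos_powR a s : R := (0 <= s)%R%:R * s `^ a.

Lemma pos_powR_ge0 a s : 0 <= pos_powR a s.
Proof. by rewrite mulr_ge0// powR_ge0. Qed.

Lemma ge0_pos_powR a s : 0 <= s -> pos_powR a s = s `^ a.
Proof. by rewrite /pos_powR => ->; rewrite mul1r. Qed.

Lemma lt0_pos_powR a s : s < 0 -> pos_powR a s = 0.
Proof. by rewrite /pos_powR leNgt => ->; rewrite mul0r. Qed.

Lemma pos_powRM a (r s : R) : 0 < r -> pos_powR a (r * s) = r `^ a * pos_powR a s.
Proof.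
move=> r0; have [s0|s0] := leP 0 s.
  by rewrite (ge0_pos_powR _ s0) ge0_pos_powR ?mulr_ge0 ?(ltW r0)// powRM// ltW.
by rewrite !lt0_pos_powR ?mulr0// pmulr_rlt0.
Qed.

Lemma le_pos_powR a : 0 <= a -> {homo pos_powR a : s t / s <= t}.
Proof.
move=> a0 s t st; have [s0|s0] := leP 0 s; last first.
  by rewrite lt0_pos_powR// pos_powR_ge0.
by rewrite !ge0_pos_powR ?(le_trans s0)// ge0_ler_powR// nnegrE// (le_trans s0).
Qed.

Lemma measurable_pos_powR a : measurable_fun [set: R] (pos_powR a).
Proof.
rewrite (_ : pos_powR a =
    fun s : R => \1_(`[(0 : R), +oo[%classic) s * s `^ a); last first.
  by apply/funext => s; rewrite /pos_powR indicE mem_setE in_itv/= andbT.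
by apply: measurable_funM; [exact: measurable_indic|exact: measurable_powR].
Qed.

Lemma measurable_abs_powR p : measurable_fun [set: R] (fun t : R => `|t| `^ p).
Proof. exact: measurableT_comp (measurable_powR p) (@normr_measurable _ _). Qed.

End pos_powR.

(** * Volumes of the balls of l_p *)

Lemma volumeS (R : realType) n (A : set 'rV[R]_n.+1) : volume A =
  (\int[lebesgue_measure]_t
     volume [set x : 'rV[R]_n | A (row_mx (t%:M : 'rV_1) x)])%E.
Proof. by []. Qed.

Section pball.
Context {R : realType} (p : R).
Hypothesis p1 : 1 <= p.
Let p0 : 0 < p. Proof. exact: lt_le_trans p1. Qed.
Let pn0 : p != 0. Proof. exact: lt0r_neq0. Qed.

(** Balls are indexed by the p-th power rho of their radius: a hyperplane section
    is then a ball of the same family, of index rho - |t|^p, empty when this is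
    negative. *)
Definition pball n (rho : R) : set 'rV[R]_n :=
  [set x | \sum_(i < n) `|x ord0 i| `^ p <= rho].

Lemma pball_row_mx n rho t (x : 'rV[R]_n) :
  pball rho (row_mx (t%:M : 'rV_1) x : 'rV_n.+1) = pball (rho - `|t| `^ p) x.
Proof.
rewrite /pball/= big_ord_recl row_mx_ord0 lerBrDl.
rewrite (eq_bigr (fun i => `|x ord0 i| `^ p))// => i _.
by rewrite -(row_mx_lift0 t x i).
Qed.

Lemma volume_pball0 rho : volume (@pball 0 rho) = (pos_powR 0 rho)%:E.
Proof.
rewrite /= diracE /pball; have [r0|r0] := leP 0 rho.
  by rewrite ge0_pos_powR// powRr0 mem_set//= big_ord0.
by rewrite lt0_pos_powR// memNset//= big_ord0; apply/negP; rewrite -ltNge.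
Qed.

Lemma volume_pballS n rho : (volume (@pball n.+1 rho) =
  \int[lebesgue_measure]_t volume (@pball n (rho - `|t| `^ p)))%E.
Proof.
rewrite volumeS; apply: eq_integral => t _; congr (volume _); apply/seteqP.
by split => x; rewrite /= pball_row_mx.
Qed.

Lemma measurable_slice a (rho : R) :
  measurable_fun [set: R] (fun t : R => pos_powR a (rho - `|t| `^ p)).
Proof.
apply: measurableT_comp (measurable_pos_powR a) _.
by apply: measurable_funB => //; exact: measurable_abs_powR.
Qed.

(** Substitution t = rho^(1/p) u. *)
Lemma integral_slice a rho : 0 < rho ->
  (\int[lebesgue_measure]_t (pos_powR a (rho - `|t| `^ p))%:E =
   (rho `^ (a + p^-1))%:E *
   \int[lebesgue_measure]_t (pos_powR a (1 - `|t| `^ p))%:E)%E.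
Proof.
move=> r0.
pose s := rho `^ p^-1.
have s0 : 0 < s by exact: powR_gt0.
have sp : s `^ p = rho by rewrite /s -powRrM mulVf// powRr1// ltW.
transitivity (\int[lebesgue_measure]_t (rho `^ a *
   (pos_powR a (1 - `|s^-1 * t| `^ p)))%:E)%E.
  apply: eq_integral => t _; rewrite -pos_powRM//; congr (pos_powR _ _)%:E.
  have -> : `|s^-1 * t| `^ p = rho^-1 * `|t| `^ p.
    rewrite normrM powRM// gtr0_norm ?invr_gt0// -powR_inv1 ?(ltW s0)//.
    by rewrite powRAC sp powR_inv1// ltW.
  by rewrite mulrBr mulr1 mulrA mulfV ?mul1r// lt0r_neq0.
have mslice : measurable_fun [set: R] (fun t : R => pos_powR a (1 - `|t| `^ p)).
  exact: measurable_slice.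
have msc : measurable_fun [set: R]
    (fun t : R => pos_powR a (1 - `|s^-1 * t| `^ p)).
  exact: (measurableT_comp mslice (mulrl_measurable _)).
apply: (etrans (ge0_integral_realZl (powR_ge0 _ _) msc
  (fun=> pos_powR_ge0 _ _))).
have sV0 : 0 < s^-1 by rewrite invr_gt0.
have /measurable_EFinP mE := mslice.
have E0 (t : R) : (0 <= (pos_powR a (1 - `|t| `^ p))%:E)%E.
  by rewrite lee_fin pos_powR_ge0.
apply: (etrans (congr1 (mule _) (ge0_integral_scale sV0 mE E0))).
by rewrite muleA -EFinM invrK powRD// lt0r_neq0// implybT.
Qed.

Lemma integral_slice0 a rho : rho <= 0 ->
  (\int[lebesgue_measure]_t (pos_powR a (rho - `|t| `^ p))%:E = 0)%E.
Proof.
move=> r0.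
rewrite -(integral_set1 (fun t => (pos_powR a (rho - `|t| `^ p))%:E) 0).
rewrite [RHS]integral_mkcond/=; apply: eq_integral => t _.
rewrite patchE; case: ifPn => // /negP tn0; rewrite lt0_pos_powR//.
rewrite subr_lt0 (le_lt_trans r0)// powR_gt0// normr_gt0.
by apply/eqP => t0; apply: tn0; rewrite inE.
Qed.

Lemma slice_fin_num a : 0 <= a ->
  (\int[lebesgue_measure]_t (pos_powR a (1 - `|t| `^ p))%:E)%E \is a fin_num.
Proof.
move=> a0; rewrite ge0_fin_numE; last first.
  by apply: integral_ge0 => t _; rewrite lee_fin pos_powR_ge0.
apply: (le_lt_trans (@integral_le_itv _ _ (-1) 1 1 _ _ _ _ _ _)) => //.
- exact: measurable_slice.
- by move=> t; exact: pos_powR_ge0.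
- move=> t _; have [h|h] := leP 0 (1 - `|t| `^ p); last by rewrite lt0_pos_powR.
  have e1 : (1 : R) `^ a = 1 by rewrite powR1.
  rewrite ge0_pos_powR// -[leRHS]e1 ge0_ler_powR ?nnegrE// gerBl.
- move=> t; rewrite -ler_norml -ltNge => t1.
  have e1 : (1 : R) `^ p = 1 by rewrite powR1.
  by rewrite lt0_pos_powR// subr_lt0 -[ltLHS]e1 gt0_ltr_powR ?nnegrE.
- exact: ltry.
Qed.

(** Homogeneity of volume. Besides scaling, the explicit dependence on rho makes
    the volumes of sections measurable functions of the cutting point, as
    Tonelli's theorem requires; the constant v, the volume of the unit ball,
    cancels in probabilities. *)
Lemma volume_pball n : exists2 v, 0 <= v & forall rho,
  (volume (@pball n rho) = (v * pos_powR (n%:R / p) rho)%:E)%E.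
Proof.
elim: n => [|n [v v0 IH]].
  by exists 1 => // rho; rewrite mul0r mul1r volume_pball0.
have a0 : 0 <= n%:R / p by rewrite divr_ge0// ltW.
have S rho : (volume (@pball n.+1 rho) = v%:E *
    \int[lebesgue_measure]_t (pos_powR (n%:R / p) (rho - `|t| `^ p))%:E)%E.
  rewrite volume_pballS -ge0_integral_realZl//.
  - by apply: eq_integral => t _; rewrite IH.
  - exact: measurable_slice.
  - by move=> t; exact: pos_powR_ge0.
exists (v * fine (\int[lebesgue_measure]_t
    (pos_powR (n%:R / p) (1 - `|t| `^ p))%:E)).
  rewrite mulr_ge0// fine_ge0//.
  by apply: integral_ge0 => t _; rewrite lee_fin pos_powR_ge0.
move=> rho; rewrite S; have [r0|r0] := ltP 0 rho.
  rewrite integral_slice// -(fineK (slice_fin_num a0)) -!EFinM; congr EFin.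
  rewrite ge0_pos_powR 1?ltW// -[in RHS]addn1 natrD mulrDl mul1r; ring.
rewrite integral_slice0// mule0; have [h|h] := ltP rho 0.
  by rewrite lt0_pos_powR// mulr0.
have -> : rho = 0 by apply/le_anti/andP.
by rewrite ge0_pos_powR// powR0 ?mulr0// mulf_neq0 ?invr_neq0// pnatr_eq0.
Qed.
End pball.

Section volume_bounds.
Context {R : realType} (p : R).
Hypothesis p1 : 1 <= p.
Let p0 : 0 < p. Proof. exact: lt_le_trans p1. Qed.

(** The ball contains the cube [-s, s]^n. *)
Lemma volume_pball_ge n (s rho : R) : 0 <= s -> n%:R * s `^ p <= rho ->
  (((2 * s) ^+ n)%:E <= volume (pball p rho : set 'rV_n))%E.
Proof.
move=> s0; elim: n rho => [|n IH] rho srho.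
  rewrite volume_pball0// ge0_pos_powR ?powRr0//.
  by rewrite mul0r in srho.
rewrite volume_pballS.
have [v v0 vE] := volume_pball p1 n.
under eq_integral do rewrite vE.
apply: le_trans (@integral_ge_itv _ _ (- s) s ((2 * s) ^+ n) _ _ _ _ _).
- rewrite lee_fin opprK exprSr; lra.
- lra.
- by rewrite exprn_ge0// mulr_ge0.
- by apply: measurable_funM => //; exact: measurable_slice.
- by move=> t; rewrite mulr_ge0// pos_powR_ge0.
move=> t ts; rewrite -lee_fin -vE; apply: IH.
have : `|t| `^ p <= s `^ p by rewrite ge0_ler_powR ?nnegrE ?ler_norml// ltW.
by move: srho; rewrite -natr1 mulrDl mul1r; lra.
Qed.

(** Integrate the pointwise bound
    1_{S <= rho} <= exp (b^p (rho - S)), S = sum_i |x_i|^p, whose right-hand side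
    is a product of one-dimensional functions; the induction performs this
    integration one coordinate at a time. *)
Lemma volume_pball_le n (b rho : R) : 0 < b ->
  (volume (pball p rho : set 'rV_n) <=
     (expR (b `^ p * rho) * (2 * expR 1 / b) ^+ n)%:E)%E.
Proof.
move=> b0; elim: n rho => [|n IH] rho.
  rewrite volume_pball0// expr0 mulr1 lee_fin.
  have [r0|r0] := leP 0 rho; last by rewrite lt0_pos_powR// expR_ge0.
  by rewrite ge0_pos_powR// powRr0 -expR0 ler_expR mulr_ge0// powR_ge0.
rewrite volume_pballS.
set I := 2 * expR 1 / b in IH *.
have I0 : 0 <= I by rewrite divr_ge0 ?mulr_ge0 ?expR_ge0// ltW.
have [v v0 vE] := volume_pball p1 n.
pose c := expR (b `^ p * rho) * I ^+ n.
have c0 : 0 <= c by rewrite mulr_ge0 ?expR_ge0 ?exprn_ge0.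
have mexp := measurable_expR_powR p b.
apply: (@le_trans _ _ (\int[lebesgue_measure]_t
    (c * expR (- (b * `|t|) `^ p))%:E)%E).
  under eq_integral do rewrite vE.
  apply: ge0_le_integral => //=.
  - by move=> t _; rewrite lee_fin mulr_ge0// pos_powR_ge0.
  - by apply/measurable_EFinP; apply: measurable_funM => //; exact: measurable_slice.
  - by apply/measurable_EFinP; exact: measurable_funM.
  move=> t _; rewrite -vE; apply: le_trans (IH _) _.
  by rewrite lee_fin /c mulrAC -expRD powRM ?(ltW b0)// mulrBr.
rewrite (ge0_integral_realZl c0 mexp (fun=> expR_ge0 _)).
apply: (@le_trans _ _ (c%:E * I%:E)%E).
  by apply: lee_wpmul2l => //; exact: integral_expR_powR_le.
by rewrite -EFinM lee_fin /c exprSr mulrA.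
Qed.

End volume_bounds.

Section radius.
Context {R : realType} (p : R) (n : nat).
Hypothesis p1 : 1 <= p.
Let p0 : 0 < p. Proof. exact: lt_le_trans p1. Qed.
Let pn0 : p != 0. Proof. exact: lt0r_neq0. Qed.
Let pV0 : 0 < p^-1. Proof. by rewrite invr_gt0. Qed.
Let pV1 : p^-1 <= 1. Proof. by rewrite invf_le1. Qed.
Let m : R := n.+1%:R.
Let m0 : 0 < m. Proof. by rewrite ltr0n. Qed.

Lemma lpball_pball k : lpball p%:E = pball p 1 :> set 'rV[R]_k.
Proof.
apply/seteqP; split => x /=; rewrite /lpball /lpnorm /pball /=;
  set S := \sum_(_ < _) _;
  have S0 : 0 <= S by apply: sumr_ge0 => i _; exact: powR_ge0.
  have e1 : (1 : R) `^ p = 1 by rewrite powR1.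
  move=> h; rewrite -(powRVK pn0 S0) -[leRHS]e1.
  by rewrite ge0_ler_powR// ?nnegrE ?powR_ge0// ltW.
have e1 : (1 : R) `^ p^-1 = 1 by rewrite powR1.
by move=> h; rewrite -[leRHS]e1 ge0_ler_powR// ?nnegrE ltW.
Qed.

(** The ball of volume one is the unit ball divided by this number. *)
Definition lp_volume_radius : R :=
  fine (volume (lpball p%:E : set 'rV[R]_n.+1)) `^ m^-1.
Local Notation r := lp_volume_radius.

Lemma volume_radius_ge : 2 * m `^ (- p^-1) <= r.
Proof.
have s0 : 0 <= m `^ (- p^-1) by exact: powR_ge0.
have := @volume_pball_ge R p p1 n.+1 (m `^ (- p^-1)) 1 s0.
rewrite -/m -powRrM mulNr mulVf// powRN powRr1 ?(ltW m0)//.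
rewrite mulfV ?lt0r_neq0// => /(_ (lexx _)).
rewrite /lp_volume_radius lpball_pball.
have [v v0 ->] := @volume_pball R p p1 n.+1.
rewrite /= lee_fin => h; set w := v * _ in h *.
have s20 : 0 <= 2 * m `^ (- p^-1) by rewrite mulr_ge0.
rewrite -[leLHS](powRKV (lt0r_neq0 m0) s20) powR_mulrn//.
rewrite ge0_ler_powR// ?invr_ge0 ?(ltW m0)// nnegrE ?exprn_ge0//.
by rewrite (le_trans _ h)// exprn_ge0.
Qed.

Lemma volume_radius_gt0 : 0 < r.
Proof. by rewrite (lt_le_trans _ volume_radius_ge)// mulr_gt0// powR_gt0. Qed.

Lemma volume_radius_le : r <= 2 * expR 1 ^+ 3 * m `^ (- p^-1).
Proof.
pose b := (m / p) `^ p^-1.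
have mp0 : 0 < m / p by rewrite divr_gt0.
have b0 : 0 < b by exact: powR_gt0.
(* b^p = m / p makes the exponential factor e^(m/p), whose m-th root is at
   most e; the rest is (2 e / b)^m with 1 / b <= e m^(-1/p) *)
have := @volume_pball_le R p p1 n.+1 b 1 b0.
rewrite /lp_volume_radius lpball_pball.
have [v v0 ->] := @volume_pball R p p1 n.+1.
rewrite lee_fin /= => h.
set w := v * _ in h *.
have w0 : 0 <= w by rewrite mulr_ge0// pos_powR_ge0.
have I0 : 0 <= 2 * expR 1 / b by rewrite divr_ge0 ?mulr_ge0 ?expR_ge0// ltW.
have mn0 := lt0r_neq0 m0.
have mV0 : 0 <= m^-1 by rewrite invr_ge0 ltW.
apply: (le_trans (ge0_ler_powR mV0 _ _ h)); rewrite ?nnegrE//.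
  by rewrite mulr_ge0 ?expR_ge0 ?exprn_ge0.
rewrite mulr1 powRVK ?(ltW mp0)// powRM ?expR_ge0 ?exprn_ge0//.
rewrite -powR_mulrn// -/m powRKV// -expRM mulrAC mulfV// mul1r.
have pp : (p / m) `^ p^-1 <= expR 1 * m `^ (- p^-1).
  rewrite powRM ?invr_ge0 ?(ltW p0)// ?(ltW m0)// -[m^-1]powR_inv1 ?(ltW m0)//.
  rewrite -powRrM mulN1r ler_wpM2r ?powR_ge0//; exact: le_powRV_expR1.
have -> : b^-1 = (p / m) `^ p^-1.
  rewrite -[p / m]invf_div -[(m / p)^-1]powR_inv1 ?(ltW mp0)//.
  by rewrite -powRrM mulN1r powRN.
have e0 := expR_gt0 (1 : R).
have ep : expR p^-1 <= expR 1 by rewrite ler_expR.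
apply: (@le_trans _ _ (expR 1 * (2 * expR 1 * (expR 1 * m `^ (- p^-1))))).
  apply: ler_pM; rewrite ?expR_ge0//.
    by rewrite !mulr_ge0 ?powR_ge0// ltW.
  by apply: ler_wpM2l => //; rewrite mulr_ge0// ltW.
rewrite le_eqVlt; apply/orP; left; apply/eqP; ring.
Qed.
End radius.

Lemma pball_image_scale (R : realType) (p : R) n (c : R) : p != 0 -> 0 < c ->
  [set c *: x | x in pball p 1] = pball p (c `^ p) :> set 'rV[R]_n.
Proof.
move=> pn0 c0.
have sumZ (k : R) (x : 'rV[R]_n) : 0 <= k ->
    \sum_(i < n) `|(k *: x) ord0 i| `^ p =
    k `^ p * \sum_(i < n) `|x ord0 i| `^ p.
  move=> k0; rewrite mulr_sumr; apply: eq_bigr => i _.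
  by rewrite mxE normrM ger0_norm// powRM.
apply/seteqP; split => [_ [x hx <-]|y hy].
  by rewrite /pball /= sumZ ?(ltW c0)// -[leRHS]mulr1 ler_wpM2l// powR_ge0.
exists (c^-1 *: y); last by rewrite scalerA mulfV ?scale1r// lt0r_neq0.
rewrite /pball /= sumZ ?invr_ge0 ?(ltW c0)//.
rewrite -powR_inv1 ?(ltW c0)// powRAC powR_inv1 ?powR_ge0//.
by rewrite ler_pdivrMl ?powR_gt0// mulr1.
Qed.

(** The only facts about the volume radius that the tail estimates need. *)
Lemma normalized_lpball_radius (R : realType) (p : R) n : 1 <= p ->
  exists r : R, [/\ 2 * n.+1%:R `^ (- p^-1) <= r,
    r <= 2 * expR 1 ^+ 3 * n.+1%:R `^ (- p^-1) &
    normalized_lpball p%:E = pball p (r^-1 `^ p) :> set 'rV[R]_n.+1].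
Proof.
move=> p1; have p0 : 0 < p by exact: lt_le_trans p1.
exists (lp_volume_radius p n); split.
- exact: volume_radius_ge.
- exact: volume_radius_le.
have r0 : 0 < lp_volume_radius p n by exact: volume_radius_gt0.
rewrite /normalized_lpball -/(lp_volume_radius p n) lpball_pball//.
by apply: pball_image_scale; rewrite ?lt0r_neq0 ?invr_gt0.
Qed.

(** * The law of one coordinate *)

Section marginal.
Context {R : realType} (p : R).
Hypothesis p1 : 1 <= p.

Lemma volume_pball_coord0 n (D : set R) rho :
  volume [set x : 'rV[R]_n.+1 | D (x ord0 ord0) /\ pball p rho x] =
  (\int[lebesgue_measure]_u
     ((\1_D u)%:E * volume (pball p (rho - `|u| `^ p) : set 'rV_n)))%E.
Proof.
rewrite volumeS; apply: eq_integral => t _; rewrite indicE.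
have [/set_mem tD|tD] := boolP (t \in D).
  rewrite mul1e; congr (volume _); apply/seteqP.
  by split => x; rewrite /= pball_row_mx row_mx_ord0; [case|].
rewrite mul0e -(volume0 R n); congr (volume _); apply/seteqP.
by split => x //=; rewrite row_mx_ord0 => -[/mem_set]; rewrite (negbTE tD).
Qed.

(** For the first coordinate this is the definition of volume; Tonelli's theorem
    moves any other coordinate to the outermost integral. *)
Lemma volume_pball_coord n (j : 'I_n.+1) (D : set R) rho : measurable D ->
  volume [set x : 'rV[R]_n.+1 | D (x ord0 j) /\ pball p rho x] =
  (\int[lebesgue_measure]_u
     ((\1_D u)%:E * volume (pball p (rho - `|u| `^ p) : set 'rV_n)))%E.
Proof.
move=> mD; elim: n j rho => [|n IH] j rho; case: (unliftP ord0 j) => [j' ->|->].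
- by case: j'.
- exact: volume_pball_coord0.
- transitivity (\int[lebesgue_measure]_t volume [set x : 'rV[R]_n.+1 |
      D (x ord0 j') /\ pball p (rho - `|t| `^ p) x])%E.
    rewrite volumeS; apply: eq_integral => t _; congr (volume _).
    by apply/seteqP; split => x; rewrite /= pball_row_mx row_mx_lift0.
  under eq_integral do rewrite IH.
  have [v v0 vE] := volume_pball p1 n.
  pose f (z : measurableTypeR R * measurableTypeR R) : \bar R :=
    (\1_D z.2 * (v * pos_powR (n%:R / p) (rho - `|z.1| `^ p - `|z.2| `^ p)))%:E.
  have f0 z : (0 <= f z)%E.
    by rewrite lee_fin mulr_ge0// mulr_ge0// pos_powR_ge0.
  have mf : measurable_fun setT f.
    apply/measurable_EFinP; apply: measurable_funM.
      exact: (measurableT_comp (measurable_indic mD) measurable_snd).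
    apply: measurable_funM => //.
    apply: (measurableT_comp (measurable_pos_powR _)).
    apply: measurable_funB.
      apply: measurable_funB => //.
      exact: (measurableT_comp (measurable_abs_powR p) measurable_fst).
    exact: (measurableT_comp (measurable_abs_powR p) measurable_snd).
  transitivity (\int[lebesgue_measure]_t \int[lebesgue_measure]_u f (t, u))%E.
    by apply: eq_integral => t _; apply: eq_integral => u _; rewrite vE.
  rewrite (fubini_tonelli (m1 := lebesgue_measure) (m2 := lebesgue_measure) f mf f0).
  apply: eq_integral => u _; rewrite volume_pballS /f /= indicE.
  have [/set_mem uD|uD] := boolP (u \in D).
    by rewrite mul1e; apply: eq_integral => t _; rewrite vE mul1r addrAC.
  by rewrite mul0e; apply: integral0_eq => t _; rewrite mul0r.
- exact: volume_pball_coord0.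
Qed.
End marginal.

Lemma measurable_coord (R : realType) n (j : 'I_n) :
  measurable_fun [set: 'rV[R]_n] (fun x : 'rV[R]_n => x ord0 j).
Proof.
move=> _ A mA; rewrite setTI; apply: sub_sigma_algebra.
by rewrite (bigD1 j)//=; left; exists A => //; rewrite setTI.
Qed.

Lemma measurable_coord_set (R : realType) n (j : 'I_n) (D : set R) :
  measurable D -> measurable [set x : 'rV[R]_n | D (x ord0 j)].
Proof.
move=> mD; rewrite (_ : mkset _ = (fun x : 'rV[R]_n => x ord0 j) @^-1` D)//.
by rewrite -[X in measurable X]setTI; exact: measurable_coord.
Qed.

Lemma measurable_abs_coord (R : realType) n d (T : measurableType d)
    (P : probability T R) (X : {RV P >-> 'rV[R]_n}) (j : 'I_n) :
  measurable_fun setT (fun w => `|X w ord0 j|).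
Proof.
apply: measurableT_comp => //.
exact: (measurableT_comp (measurable_coord j) (measurable_funPT X)).
Qed.

Section marginal_density.
Context {R : realType} (p : R) (n : nat) (r : R).
Hypothesis p1 : 1 <= p.
Hypothesis r0 : 0 < r.
Let p0 : 0 < p. Proof. exact: lt_le_trans p1. Qed.
Let pn0 : p != 0. Proof. exact: lt0r_neq0. Qed.
Let m : R := n.+1%:R.
Let m0 : 0 < m. Proof. by rewrite ltr0n. Qed.
Let a : R := n%:R / p.
Let a0 : 0 <= a. Proof. by rewrite divr_ge0// ltW. Qed.

(** Up to a constant, the density of a coordinate of a uniform point of
    {sum_i (r |x_i|)^p <= 1} in dimension n + 1. *)
Definition marginal_density (u : R) : R := pos_powR a (1 - (r * `|u|) `^ p).
Local Notation q := marginal_density.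

Definition marginal_mass (D : set R) : \bar R :=
  (\int[lebesgue_measure]_u (\1_D u * q u)%:E)%E.

Lemma marginal_density_ge0 u : 0 <= q u. Proof. exact: pos_powR_ge0. Qed.

Lemma measurable_marginal_density : measurable_fun [set: R] q.
Proof.
apply: (measurableT_comp (measurable_pos_powR _)).
apply: measurable_funB => //.
have mr : measurable_fun [set: R] (fun t : R => r * `|t|) by exact: measurable_funM.
exact: (measurableT_comp (measurable_powR p) mr).
Qed.

Lemma marginal_density_le_expR u : q u <= expR (- (a * (r * `|u|) `^ p)).
Proof.
rewrite /marginal_density; set x := _ `^ p.
have [x1|x1] := leP 0 (1 - x); last by rewrite lt0_pos_powR// expR_ge0.
rewrite ge0_pos_powR// -mulrN mulrC expRM ge0_ler_powR// ?nnegrE ?expR_ge0//.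
exact: expR_ge1Dx.
Qed.

Lemma marginal_density_eq0 u : r^-1 < `|u| -> q u = 0.
Proof.
move=> ru; rewrite /marginal_density lt0_pos_powR// subr_lt0.
have e1 : (1 : R) `^ p = 1 by rewrite powR1.
have ru1 : 1 < r * `|u| by rewrite -ltr_pdivrMl// mulr1.
by rewrite -[ltLHS]e1 gt0_ltr_powR ?nnegrE// ltW// (lt_trans _ ru1).
Qed.

Lemma measurable_marginal_mass D : measurable D ->
  measurable_fun [set: R] (fun u => \1_D u * q u).
Proof.
move=> mD; apply: measurable_funM; first exact: measurable_indic.
exact: measurable_marginal_density.
Qed.

Lemma indic_marginal_density_ge0 D u : 0 <= \1_D u * q u.
Proof. by rewrite mulr_ge0// marginal_density_ge0. Qed.

Lemma measurable_abs_ge (t : R) : measurable [set u : R | t <= `|u|].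
Proof.
exact: (measurable_superlevel t (@normr_measurable R setT)).
Qed.

(** The density is at most its exponential majorant at t on D, and it vanishes
    outside [-1/r, 1/r]. *)
Lemma marginal_mass_tail_le (D : set R) (t : R) : measurable D -> 0 <= t ->
  D `<=` [set u | t <= `|u|] ->
  (marginal_mass D <= (2 / r * expR (- (a * (r * t) `^ p)))%:E)%E.
Proof.
move=> mD t0 Dt.
apply: (le_trans (@integral_le_itv _ _ (- r^-1) r^-1
  (expR (- (a * (r * t) `^ p))) _ _ _ _ _ _)).
- by rewrite ge0_cp// invr_ge0 ltW.
- exact: expR_ge0.
- exact: measurable_marginal_mass.
- exact: indic_marginal_density_ge0.
- move=> u _; rewrite indicE.
  have [/set_mem /Dt /= tu|uD] := boolP (u \in D); last by rewrite mul0r expR_ge0.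
  rewrite mul1r (le_trans (marginal_density_le_expR u))// ler_expR lerN2.
  rewrite ler_wpM2l// ge0_ler_powR ?(ltW p0)// ?nnegrE ?mulr_ge0 ?(ltW r0)//.
  by rewrite ler_wpM2l// ltW.
- move=> u; rewrite -ler_norml -ltNge => ru.
  by rewrite marginal_density_eq0// mulr0.
by rewrite lee_fin; lra.
Qed.

Lemma marginal_mass_fin_num D : measurable D -> marginal_mass D \is a fin_num.
Proof.
move=> mD; rewrite ge0_fin_numE; last first.
  by apply: integral_ge0 => u _; rewrite lee_fin indic_marginal_density_ge0.
apply: (le_lt_trans (@marginal_mass_tail_le D 0 mD (lexx _) _)).
  by move=> u _ /=.
exact: ltry.
Qed.

(** Let m = n + 1. On the interval |u| <= m^(-1/p) / r the density is at least
    (1 - 1/m)^(n/p) >= exp (-1/p) >= 1/e. *)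
Lemma marginal_mass_ge : (0 < n)%N ->
  ((2 * m `^ (- p^-1) / (expR 1 * r))%:E <= marginal_mass setT)%E.
Proof.
move=> n0; pose s := m `^ (- p^-1) / r.
have s0 : 0 <= s by rewrite divr_ge0 ?powR_ge0// ltW.
apply: le_trans (@integral_ge_itv _ _ (- s) s (expR 1)^-1 _ _ _ _ _).
- rewrite lee_fin opprK /s le_eqVlt; apply/orP; left; apply/eqP.
  by field; rewrite !lt0r_neq0// expR_gt0.
- lra.
- by rewrite invr_ge0 expR_ge0.
- exact: measurable_marginal_mass.
- exact: indic_marginal_density_ge0.
move=> u; rewrite -ler_norml => us; rewrite indicE in_setT mul1r.
have nR0 : 0 < n%:R :> R by rewrite ltr0n.
have mE : m = n%:R + 1 by rewrite /m -natr1.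
have xm : (r * `|u|) `^ p <= m^-1.
  have -> : m^-1 = (m `^ (- p^-1)) `^ p.
    by rewrite -powRrM mulNr mulVf// powR_inv1// ltW.
  rewrite ge0_ler_powR ?(ltW p0)// ?nnegrE ?mulr_ge0 ?(ltW r0)// ?powR_ge0//.
  by rewrite mulrC -ler_pdivlMr.
have m1 : n%:R / m = 1 - m^-1.
  by rewrite mE; field; rewrite -mE lt0r_neq0.
apply: (@le_trans _ _ ((n%:R / m) `^ a)); last first.
  rewrite -[leLHS]ge0_pos_powR ?divr_ge0 ?(ltW m0)//.
  by apply: le_pos_powR => //; rewrite m1 lerD2l lerN2.
have nm0 : 0 < n%:R / m by rewrite divr_gt0.
rewrite -[n%:R / m]lnK ?posrE// -expRM -expRN ler_expR.
have -> : ln (n%:R / m) = - ln (m / n%:R).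
  by rewrite -lnV ?posrE ?divr_gt0// invf_div.
rewrite mulNr lerN2.
have lnm : ln (m / n%:R) <= n%:R^-1.
  have -> : m / n%:R = 1 + n%:R^-1 by rewrite mE; field; rewrite lt0r_neq0.
  by apply: le_ln1Dx; rewrite (lt_trans _ (_ : 0 < _))// invr_gt0.
apply: (@le_trans _ _ (n%:R^-1 * a)); first by rewrite ler_wpM2r.
by rewrite /a mulrA mulVf ?lt0r_neq0// mul1r invf_le1.
Qed.

(** The mass of [t, 2t] is enough; there the density is bounded below by means of
    1 - x >= exp (- 2 x), valid for 0 <= x <= 1/2. *)
Lemma marginal_mass_tail_ge (t : R) : 0 <= t -> (2 * (r * t)) `^ p <= 2^-1 ->
  ((t * expR (- (2 * (a * (2 * (r * t)) `^ p))))%:E <=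
   marginal_mass [set u : R | (t <= `|u|)%R])%E.
Proof.
move=> t0 ht.
apply: le_trans (@integral_ge_itv _ _ t (2 * t)
  (expR (- (2 * (a * (2 * (r * t)) `^ p)))) _ _ _ _ _).
- by rewrite lee_fin le_eqVlt; apply/orP; left; apply/eqP; ring.
- lra.
- exact: expR_ge0.
- by apply: measurable_marginal_mass; exact: measurable_abs_ge.
- exact: indic_marginal_density_ge0.
move=> u /andP[tu ut]; have u0 : 0 <= u by exact: le_trans tu.
rewrite indicE mem_set ?mul1r/=; last by rewrite ger0_norm.
rewrite /marginal_density ger0_norm//; set x := _ `^ p.
have x0 : 0 <= x by exact: powR_ge0.
have xu : (r * u) `^ p <= x.
  rewrite ge0_ler_powR ?(ltW p0)// ?nnegrE ?mulr_ge0 ?(ltW r0)//.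
  by rewrite mulrCA ler_wpM2l// ltW.
have x2 : x <= 2^-1 by [].
have x1 : 0 < 1 - x by lra.
have e2 : expR (- (2 * x)) <= 1 - x.
  rewrite expRN -[leRHS]invrK lef_pV2 ?posrE ?expR_gt0 ?invr_gt0//.
  rewrite (le_trans _ (expR_ge1Dx _))// -[leLHS]mul1r ler_pdivrMr//.
  have x12 : 0 <= 1 - 2 * x by lra.
  by have := mulr_ge0 x0 x12; lra.
apply: (@le_trans _ _ (pos_powR a (1 - x))); last first.
  by apply: le_pos_powR => //; rewrite lerD2l lerN2.
rewrite ge0_pos_powR ?(ltW x1)// mulrCA -mulrN mulrC expRM.
by rewrite ge0_ler_powR// nnegrE ?expR_ge0// ltW.
Qed.

Lemma marginal_mass_le : (0 < n)%N ->
  (marginal_mass setT <= (2 * expR 1 / (a `^ p^-1 * r))%:E)%E.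
Proof.
move=> n0; have aa0 : 0 < a by rewrite divr_gt0// ltr0n.
have b0 : 0 < a `^ p^-1 * r by rewrite mulr_gt0// powR_gt0.
apply: le_trans (integral_expR_powR_le p1 b0).
apply: ge0_le_integral => //=.
- by move=> u _; rewrite lee_fin indic_marginal_density_ge0.
- by apply/measurable_EFinP; exact: measurable_marginal_mass.
- by apply/measurable_EFinP; exact: measurable_expR_powR.
move=> u _; rewrite lee_fin indicE in_setT mul1r.
rewrite -mulrA powRM ?powR_ge0 ?mulr_ge0 ?(ltW r0)// powRVK//.
exact: marginal_density_le_expR.
Qed.

End marginal_density.

Section uniform_coordinate.
Context {R : realType} (p : R) (n : nat) (r : R).
Hypothesis p1 : 1 <= p.
Hypothesis r0 : 0 < r.
Hypothesis n0 : (0 < n)%N.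
Let p0 : 0 < p. Proof. exact: lt_le_trans p1. Qed.
Let pn0 : p != 0. Proof. exact: lt0r_neq0. Qed.
Let m : R := n.+1%:R.
Let m0 : 0 < m. Proof. by rewrite ltr0n. Qed.
Let a : R := n%:R / p.

(** Factoring r^-p out of the index of each section turns the section volumes
    into [marginal_density]. *)
Lemma volume_scaled_pball_coord : exists2 c : R, 0 < c &
  forall (j : 'I_n.+1) (D : set R), measurable D ->
  volume ([set x : 'rV[R]_n.+1 | D (x ord0 j)] `&` pball p (r^-1 `^ p)) =
  (c%:E * marginal_mass p n r D)%E.
Proof.
have [v v0 vE] := @volume_pball R p p1 n.
pose rho := r^-1 `^ p.
have rho0 : 0 < rho by rewrite powR_gt0// invr_gt0.
have vgt0 : 0 < v.
  have s0 : 0 <= m `^ (- p^-1) by exact: powR_ge0.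
  have := @volume_pball_ge R p p1 n (m `^ (- p^-1)) 1 s0.
  rewrite -powRrM mulNr mulVf// powRN powRr1 ?(ltW m0)// ler_pdivrMr// mul1r.
  rewrite ler_nat leqnSn => /(_ isT); rewrite vE lee_fin.
  rewrite ge0_pos_powR// powR1 mulr1; apply: lt_le_trans.
  by rewrite exprn_gt0// mulr_gt0// powR_gt0.
exists (v * rho `^ a); first by rewrite mulr_gt0// powR_gt0.
move=> j D mD.
apply: (etrans (volume_pball_coord p1 j (r^-1 `^ p) mD)).
have c0 : 0 <= v * rho `^ a by rewrite mulr_ge0// powR_ge0.
rewrite -(ge0_integral_realZl c0 (measurable_marginal_mass p n r mD)
  (indic_marginal_density_ge0 p n r D)).
have qE (u : R) : pos_powR (n%:R / p) (rho - `|u| `^ p) =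
    rho `^ a * marginal_density p n r u.
  rewrite -pos_powRM//; congr pos_powR; rewrite mulrBr mulr1; congr (_ - _).
  rewrite -powRM ?invr_ge0 ?mulr_ge0 ?(ltW r0)// mulrA mulVf ?mul1r//.
  exact: lt0r_neq0.
apply: eq_integral => u _.
rewrite vE.
rewrite qE.
rewrite -EFinM.
apply/eqP; rewrite eqe; apply/eqP.
ring.
Qed.

Lemma uniform_coord_prob d (T : measurableType d) (P : probability T R)
    (X : {RV P >-> 'rV[R]_n.+1}) (j : 'I_n.+1) (D : set R) :
  uniformly_distributed (pball p (r^-1 `^ p)) X -> measurable D ->
  P [set w | D (X w ord0 j)] =
  (fine (marginal_mass p n r D) / fine (marginal_mass p n r setT))%:E.
Proof.
move=> uX mD.
have [c c0 cE] := volume_scaled_pball_coord.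
have := uX _ (measurable_coord_set j mD).
rewrite /distribution /pushforward cE//.
have <- : [set x : 'rV[R]_n.+1 | [set: R] (x ord0 j)] `&` pball p (r^-1 `^ p) =
     pball p (r^-1 `^ p) by rewrite (_ : mkset _ = setT) ?setTI//; exact/seteqP.
rewrite cE// -(fineK (marginal_mass_fin_num n p1 r0 mD)).
rewrite -(fineK (marginal_mass_fin_num n p1 r0 measurableT)) /= => ->.
have := marginal_mass_ge p1 r0 n0.
rewrite -(fineK (marginal_mass_fin_num n p1 r0 measurableT)) lee_fin.
set z := fine _; set x := fine _ => zlb.
have z0 : 0 < z.
  by rewrite (lt_le_trans _ zlb)// divr_gt0 ?mulr_gt0 ?powR_gt0 ?expR_gt0.
rewrite -!EFinM inver mulf_eq0 !gt_eqF//= -EFinM; congr EFin.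
by field; rewrite !lt0r_neq0.
Qed.

End uniform_coordinate.

Section coordinate_tails.
Context {R : realType} (p : R) (n : nat) (r : R).
Hypothesis p1 : 1 <= p.
Hypothesis n0 : (0 < n)%N.
Let p0 : 0 < p. Proof. exact: lt_le_trans p1. Qed.
Let pn0 : p != 0. Proof. exact: lt0r_neq0. Qed.
Let pV0 : 0 <= p^-1. Proof. by rewrite invr_ge0 ltW. Qed.
Let pV1 : p^-1 <= 1. Proof. by rewrite invf_le1. Qed.
Let m : R := n.+1%:R.
Let m0 : 0 < m. Proof. by rewrite ltr0n. Qed.
Let m1 : 1 <= m. Proof. by rewrite ler1n. Qed.
Let nm : n%:R <= m. Proof. by rewrite ler_nat. Qed.
Let mn : m <= 2 * n%:R.
Proof.
have : 1 <= n%:R :> R by rewrite ler1n.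
by rewrite /m -natr1; lra.
Qed.
Let a : R := n%:R / p.
Let a0 : 0 < a. Proof. by rewrite divr_gt0// ltr0n. Qed.
Let e := expR (1 : R).
Let e0 : 0 < e. Proof. exact: expR_gt0. Qed.
Hypothesis r_ge : 2 * m `^ (- p^-1) <= r.
Hypothesis r_le : r <= 2 * e ^+ 3 * m `^ (- p^-1).
Let s : R := m `^ (- p^-1).
Let s0 : 0 < s. Proof. exact: powR_gt0. Qed.
Let sp : s `^ p = m^-1.
Proof. by rewrite -powRrM mulNr mulVf// powR_inv1// ltW. Qed.
Let sVm : s^-1 <= m.
Proof.
rewrite /s powRN invrK; apply: ler1_powR => //.
Qed.
Let r0 : 0 < r.
Proof. by rewrite (lt_le_trans _ r_ge)// mulr_gt0. Qed.

Context d (T : measurableType d) (P : probability T R)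
  (X : {RV P >-> 'rV[R]_n.+1}) (j : 'I_n.+1).
Hypothesis uX : uniformly_distributed (pball p (r^-1 `^ p)) X.

Let mass_gt0 : 0 < fine (marginal_mass p n r setT).
Proof.
have := marginal_mass_ge p1 r0 n0.
rewrite -(fineK (marginal_mass_fin_num n p1 r0 measurableT)) lee_fin.
by apply: lt_le_trans; rewrite divr_gt0 ?mulr_gt0 ?powR_gt0 ?expR_gt0.
Qed.

Lemma uniform_coord_bounded : P [set w | m < `|X w ord0 j|] = 0.
Proof.
pose D := [set u : R | m < `|u|].
have mD : measurable D.
  exact: (measurable_strict_superlevel m (@normr_measurable R setT)).
rewrite (uniform_coord_prob p1 r0 n0 j uX mD).
rewrite (_ : marginal_mass p n r D = 0%E) ?mul0r//.
apply: integral0_eq => u _; rewrite indicE.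
have [/set_mem /= uD|uD] := boolP (u \in D); last by rewrite mul0r.
rewrite marginal_density_eq0// ?mulr0//.
apply: le_lt_trans uD; apply: le_trans sVm.
rewrite lef_pV2 ?posrE//.
apply: le_trans r_ge; rewrite -/s -[leLHS]mul1r ler_wpM2r ?ler1n//.
exact: ltW.
Qed.

(** With x = r t the exponent is a x^p, where a = n / p and
    x >= 6 e m^(-1/p) L^(1/p); since (6 e)^p >= 6 p, the division by p in a is
    compensated. *)
Lemma uniform_coord_tail_le L : 0 <= L ->
  (P [set w | (3 * e * L `^ p^-1 <= `|X w ord0 j|)%R] <=
   (e * m * expR (- (3 * L)))%:E)%E.
Proof.
move=> L0; set t := 3 * e * L `^ p^-1.
have t0 : 0 <= t by rewrite mulr_ge0 ?powR_ge0// mulr_ge0// ltW.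
pose D := [set u : R | t <= `|u|].
have mD : measurable D by exact: measurable_abs_ge.
rewrite (uniform_coord_prob p1 r0 n0 j uX mD).
have hD := marginal_mass_tail_le n p1 r0 mD t0 (fun _ h => h).
have hT := marginal_mass_ge p1 r0 n0.
rewrite -(fineK (marginal_mass_fin_num n p1 r0 measurableT)) lee_fin in hT.
rewrite -(fineK (marginal_mass_fin_num n p1 r0 mD)) lee_fin in hD.
rewrite lee_fin ler_pdivrMr// (le_trans hD)//.
have aL : 3 * L <= a * (r * t) `^ p.
  have rt : 6 * e * (s * L `^ p^-1) <= r * t.
    rewrite /t (_ : 6 * e * _ = (2 * s) * (3 * e * L `^ p^-1)); last by ring.
    by rewrite ler_wpM2r.
  have le6 : 6 * p <= (6 * e) `^ p.
    rewrite powRM// ?(ltW e0)// ler_pM// ?(ltW p0)//.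
      by apply: le1r_powR => //; lra.
    by rewrite /e -expRM mul1r; have := expR_ge1Dx p; lra.
  have sL : (s * L `^ p^-1) `^ p = L / m.
    by rewrite powRM ?powR_ge0 ?(ltW s0)// sp powRVK// mulrC.
  have h1 : 6 * p * (L / m) <= (r * t) `^ p.
    apply: (@le_trans _ _ ((6 * e * (s * L `^ p^-1)) `^ p)).
      rewrite [leRHS]powRM ?mulr_ge0 ?powR_ge0 ?(ltW e0) ?(ltW s0)// sL.
      by rewrite ler_wpM2r// divr_ge0// ltW.
    rewrite ge0_ler_powR ?(ltW p0)// nnegrE ?mulr_ge0 ?powR_ge0//.
    - exact: ltW.
    - exact: ltW.
    - exact: ltW.
  apply: (@le_trans _ _ (a * (6 * p * (L / m)))); last first.
    by rewrite ler_wpM2l// ltW.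
  rewrite (_ : a * _ = 3 * L * (2 * n%:R / m)); last first.
    by rewrite /a; field; rewrite pn0 lt0r_neq0.
  by rewrite ler_peMr ?mulr_ge0// ler_pdivlMr// mul1r.
apply: (@le_trans _ _ (2 / r * expR (- (3 * L)))).
  by rewrite ler_wpM2l ?divr_ge0 ?(ltW r0)// ler_expR lerN2.
apply: (@le_trans _ _ (e * m * expR (- (3 * L)) * (2 * s / (e * r)))); last first.
  by rewrite ler_wpM2l// mulr_ge0 ?expR_ge0 ?mulr_ge0 ?(ltW e0) ?(ltW m0).
rewrite (_ : e * m * _ * _ = 2 / r * expR (- (3 * L)) * (m * s)); last first.
  by field; rewrite !lt0r_neq0.
rewrite ler_peMr ?mulr_ge0 ?expR_ge0 ?invr_ge0 ?(ltW r0)//.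
by move: sVm; rewrite -[s^-1]mul1r ler_pdivrMr.
Qed.

(** The factor m^(-1/p) of r turns the power in the exponent into L / m up to a
    constant. The threshold is chosen so that (2 r t)^p <= L / (2 m), which makes
    the loss exp (- 2 a L / (2 m)) at least exp (- L), while 2 L <= m keeps
    (2 r t)^p below 1/2. *)
Lemma uniform_coord_tail_ge L : 2^-1 <= L -> 2 * L <= m ->
  ((expR (- L) / (32 * e ^+ 5))%:E <=
   P [set w | (L `^ p^-1 / (8 * e ^+ 3) <= `|X w ord0 j|)%R])%E.
Proof.
move=> hL Lm; have L0 : 0 <= L by lra.
set t := L `^ p^-1 / (8 * e ^+ 3).
have e30 : 0 < e ^+ 3 by rewrite exprn_gt0.
have t0 : 0 <= t by rewrite divr_ge0 ?powR_ge0 ?mulr_ge0// ltW.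
pose D := [set u : R | t <= `|u|].
have mD : measurable D by exact: measurable_abs_ge.
rewrite (uniform_coord_prob p1 r0 n0 j uX mD).
have xle : (2 * (r * t)) `^ p <= L / (2 * m).
  have rt : 2 * (r * t) <= 2^-1 * (s * L `^ p^-1).
    rewrite (_ : 2^-1 * _ = 2 * (2 * e ^+ 3 * s * t)); last first.
      by rewrite /t; field; rewrite lt0r_neq0.
    by rewrite ler_wpM2l// ler_wpM2r.
  have h2 : (2^-1 : R) `^ p <= 2^-1.
    by apply: ge1r_powR => //; apply/andP; split; lra.
  have sL : (s * L `^ p^-1) `^ p = L / m.
    by rewrite powRM ?powR_ge0 ?(ltW s0)// sp powRVK// mulrC.
  apply: (@le_trans _ _ ((2^-1 * (s * L `^ p^-1)) `^ p)).
    have rt0 : 0 <= 2 * (r * t) by rewrite mulr_ge0// mulr_ge0// ltW.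
    have sL0 : 0 <= 2^-1 * (s * L `^ p^-1).
      by rewrite mulr_ge0// mulr_ge0 ?powR_ge0// ltW.
    by rewrite ge0_ler_powR ?(ltW p0)// nnegrE.
  rewrite powRM ?mulr_ge0 ?powR_ge0 ?(ltW s0)// sL.
  rewrite (_ : L / (2 * m) = 2^-1 * (L / m)); last by field; rewrite lt0r_neq0.
  by rewrite ler_wpM2r// divr_ge0// ltW.
have xhalf : (2 * (r * t)) `^ p <= 2^-1.
  by apply: (le_trans xle); rewrite ler_pdivrMr ?mulr_gt0//; lra.
have hD := marginal_mass_tail_ge n p1 r0 t0 xhalf.
have hT := marginal_mass_le p1 r0 n0.
rewrite -(fineK (marginal_mass_fin_num n p1 r0 measurableT)) lee_fin in hT.
rewrite -(fineK (marginal_mass_fin_num n p1 r0 mD)) lee_fin in hD.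
rewrite lee_fin ler_pdivlMr//; apply: le_trans hD.
(* a^(1/p) r >= 2 (a / m)^(1/p) and a / m >= 1 / (2 p) *)
have hTe : fine (marginal_mass p n r setT) <= 2 * e ^+ 2.
  apply: (le_trans hT).
  have ar : e^-1 <= a `^ p^-1 * r.
    have h2p : (2 * p) `^ p^-1 <= 2 * e.
      rewrite powRM ?(ltW p0)// ler_pM ?powR_ge0//; last exact: le_powRV_expR1.
      by apply: ler1_powR => //; lra.
    have -> : e^-1 = (2 * e)^-1 * 2 by field; rewrite lt0r_neq0.
    apply: (@le_trans _ _ (((2 * p) `^ p^-1)^-1 * 2)).
      rewrite ler_wpM2r// lef_pV2 ?posrE ?mulr_gt0// powR_gt0// mulr_gt0//.
    apply: (@le_trans _ _ (a `^ p^-1 * (2 * s))); last first.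
      by rewrite ler_wpM2l// powR_ge0.
    have -> : a `^ p^-1 * (2 * s) = (a / m) `^ p^-1 * 2.
      rewrite powRM ?invr_ge0 ?(ltW a0) ?(ltW m0)// powR_invr ?(ltW m0)//.
      by rewrite -powRN -/s; ring.
    rewrite ler_wpM2r// -powR_invr ?mulr_ge0 ?(ltW p0)//.
    have p20 : 0 < 2 * p by rewrite mulr_gt0.
    have am0 : 0 <= a / m by rewrite divr_ge0// ltW.
    rewrite ge0_ler_powR// ?nnegrE ?invr_ge0 ?(ltW p20)//.
    rewrite /a (_ : n%:R / p / m = (2 * p)^-1 * (2 * n%:R / m)); last first.
      by field; rewrite pn0 lt0r_neq0.
    by rewrite ler_peMr ?invr_ge0 ?(ltW p20)// ler_pdivlMr// mul1r.
  rewrite ler_pdivrMr ?mulr_gt0 ?powR_gt0//.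
  rewrite -/e (_ : 2 * e = 2 * e ^+ 2 * e^-1); last first.
    by field; rewrite lt0r_neq0.
  by rewrite ler_wpM2l// mulr_ge0// exprn_ge0// ltW.
have th : (16 * e ^+ 3)^-1 <= t.
  rewrite /t (_ : (16 * e ^+ 3)^-1 = 2^-1 / (8 * e ^+ 3)); last first.
    by field; rewrite lt0r_neq0.
  have e80 : 0 <= (8 * e ^+ 3)^-1 by rewrite invr_ge0 mulr_ge0// ltW.
  by rewrite ler_wpM2r// half_le_powRV.
have exple : expR (- L) <= expR (- (2 * (a * (2 * (r * t)) `^ p))).
  rewrite ler_expR lerN2.
  apply: (@le_trans _ _ (2 * (a * (L / (2 * m))))).
    by rewrite ler_wpM2l// ler_wpM2l// ltW.
  rewrite (_ : 2 * _ = L * (n%:R / m) * p^-1); last first.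
    by rewrite /a; field; rewrite pn0 lt0r_neq0.
  have nm1 : n%:R / m <= 1 by rewrite ler_pdivrMr// mul1r.
  apply: (@le_trans _ _ (L * 1 * 1)); last by rewrite !mulr1.
  by rewrite ler_pM// ?ler_wpM2l// mulr_ge0// divr_ge0// ltW.
apply: (@le_trans _ _ (expR (- L) / (32 * e ^+ 5) * (2 * e ^+ 2))).
  by rewrite ler_wpM2l// divr_ge0 ?expR_ge0// mulr_ge0// exprn_ge0// ltW.
rewrite (_ : expR (- L) / _ * _ = (16 * e ^+ 3)^-1 * expR (- L)); last first.
  by field; rewrite lt0r_neq0.
by rewrite ler_pM ?expR_ge0// invr_ge0 mulr_ge0// ltW.
Qed.

End coordinate_tails.

(** * Maxima of random variables *)

Section expectation_of_maximum.
Context {R : realType} d (T : measurableType d) (P : probability T R) (N : nat).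
Variable Y : 'I_N -> T -> R.
Hypothesis mY : forall i, measurable_fun setT (Y i).
Let M w : R := \big[Num.max/0]_(i < N) Y i w.

Let M0 w : 0 <= M w. Proof. by apply/bigmax_geP; left. Qed.

Lemma measurable_bigmax : measurable_fun setT M.
Proof.
rewrite /M; elim: (index_enum _) => [|i s IH].
  under eq_fun do rewrite big_nil.
  exact: measurable_cst.
under eq_fun do rewrite big_cons /=.
exact: measurable_maxr (mY i) IH.
Qed.

Let mYge t i : measurable [set w | t <= Y i w].
Proof. exact: measurable_superlevel. Qed.

(** Up to null sets the maximum is at most t plus B for each index that reaches t.
    Using the crude bound B there spares an integration of tails. *)
Lemma expectation_max_le (t B q : R) : 0 <= t -> 0 <= B ->
  (forall i, P [set w | (B < Y i w)%R] = 0)%E ->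
  (forall i, P [set w | (t <= Y i w)%R] <= q%:E)%E ->
  ('E_P[M] <= (t + N%:R * (B * q))%:E)%E.
Proof.
move=> t0 B0 PB Pt.
pose E i := [set w | t <= Y i w].
have mB i : measurable_fun setT (fun w => B * \1_(E i) w : R).
  by apply: measurable_funM => //; apply: measurable_indic; exact: mYge.
have B10 (i : 'I_N) (w : T) : 0 <= B * \1_(E i) w :> R by rewrite mulr_ge0.
rewrite unlock.
apply: (@le_trans _ _ (\int[P]_w (t%:E + \sum_(i < N) (B * \1_(E i) w)%:E))%E).
  apply: ae_ge0_le_integral => //.
  - by move=> w _; rewrite lee_fin.
  - by apply/measurable_EFinP; exact: measurable_bigmax.
  - move=> w _; rewrite adde_ge0// ?lee_fin// sume_ge0// => i _.
    by rewrite lee_fin.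
  - apply: emeasurable_funD => //; apply: emeasurable_sum => i.
    exact/measurable_EFinP.
  have : \forall w \ae P, forall i, Y i w <= B.
    apply: filter_forall => i; exists [set w | B < Y i w]; split => //.
      exact: measurable_strict_superlevel.
    by move=> w /= /negP; rewrite -ltNge.
  apply: filterS => w YB _; rewrite sumEFin -EFinD lee_fin.
  have S0 : 0 <= \sum_(i < N) B * \1_(E i) w by apply: sumr_ge0.
  apply/bigmax_leP; split; first exact: addr_ge0.
  move=> i _; have [ti|it] := leP t (Y i w); last first.
    by apply: (le_trans (ltW it)); rewrite lerDl.
  apply: (le_trans (YB i)).
  rewrite (bigD1 i)//= indicE mem_set//= mulr1 addrCA lerDl addr_ge0//.
  by apply: sumr_ge0.
rewrite ge0_integralD//; last 2 first.
- by move=> w _; rewrite sume_ge0// => i _; rewrite lee_fin.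
- by apply: emeasurable_sum => i; exact/measurable_EFinP.
rewrite integral_cst//= probability_setT mule1 ge0_integral_sum//; last 2 first.
- by move=> i; exact/measurable_EFinP.
- by move=> i w _; rewrite lee_fin.
rewrite EFinD leeD2l//.
apply: (@le_trans _ _ (\sum_(i < N) (B * q)%:E)%E).
  apply: lee_sum => i _.
  under eq_integral do rewrite EFinM.
  rewrite ge0_integralZl//; last first.
  - by apply/measurable_EFinP; apply: measurable_indic; exact: mYge.
  rewrite integral_indic//; last exact: mYge.
  rewrite setIT EFinM; apply: lee_wpmul2l; last exact: Pt.
  by rewrite lee_fin.
by rewrite sumEFin lee_fin sumr_const card_ord mulr_natl lexx.
Qed.

Lemma expectation_max_ge (t q : R) : 0 <= t ->
  (q%:E <= P (\bigcup_i [set w | (t <= Y i w)%R]))%E ->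
  ((t * q)%:E <= 'E_P[M])%E.
Proof.
move=> t0 qP; rewrite unlock.
set U := \bigcup_i _ in qP.
have mU : measurable U.
  by apply: fin_bigcup_measurable => [|i _]; [exact: finite_finset|exact: mYge].
apply: (@le_trans _ _ (\int[P]_w (t * \1_U w)%:E)%E).
  under eq_integral do rewrite EFinM.
  rewrite ge0_integralZl//; last first.
    by apply/measurable_EFinP; exact: measurable_indic.
  by rewrite integral_indic// setIT EFinM; apply: lee_wpmul2l; rewrite ?lee_fin.
apply: ge0_le_integral => //=.
- by move=> w _; rewrite lee_fin mulr_ge0.
- by apply/measurable_EFinP; apply: measurable_funM.
- by apply/measurable_EFinP; exact: measurable_bigmax.
move=> w _; rewrite indicE; have [/set_mem[i _ /= ti]|wU] := boolP (w \in U).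
  rewrite mulr1 lee_fin (le_trans ti)//.
  exact: (le_bigmax_cond _ (fun i => Y i w)).
by rewrite mulr0 lee_fin.
Qed.

End expectation_of_maximum.

(** All variables avoid D with probability at most (1 - q)^N <= exp (- N q). *)
Lemma independent_union_ge (R : realType) d d' (T : measurableType d)
    (E : measurableType d') (P : probability T R) (N : nat)
    (X : 'I_N -> {RV P >-> E}) (D : set E) (q : R) :
  mutually_independent X -> measurable D ->
  (forall i, q%:E <= P (X i @^-1` D))%E ->
  ((1 - expR (- (N%:R * q)))%:E <= P (\bigcup_i (X i @^-1` D)))%E.
Proof.
move=> iX mD qD.
have mXD i : measurable (X i @^-1` D).
  by rewrite -[X in measurable X]setTI; exact: measurable_funP.
have mU : measurable (\bigcup_i (X i @^-1` D)).
  by apply: fin_bigcup_measurable => // ; exact: finite_finset.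
rewrite -[X in P X]setCK probability_setC; last exact: measurableC.
rewrite EFinB leeB// setC_bigcup.
have := iX [set: 'I_N]%SET (fun=> ~` D) (fun=> measurableC mD).
rewrite (_ : [set` [set: 'I_N]%SET] = setT); last first.
  by apply/seteqP; split => i //=; rewrite inE.
move=> ->.
have PE i : P (X i @^-1` (~` D)) = (1 - fine (P (X i @^-1` D)))%:E.
  have -> : X i @^-1` (~` D) = ~` (X i @^-1` D) by [].
  rewrite probability_setC// EFinD EFinN fineK//.
  exact: fin_num_measure.
under eq_bigr do rewrite PE.
rewrite prodEFin lee_fin -mulrN mulrC expRM.
rewrite powR_mulrn ?expR_ge0//.
rewrite (_ : _ ^+ N = \prod_(i in [set: 'I_N]%SET) expR (- q)); last first.
  by rewrite prodr_const cardsT card_ord.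
apply: ler_prod => i _; apply/andP; split.
  by rewrite subr_ge0 -lee_fin fineK ?probability_le1// fin_num_measure.
apply: le_trans (expR_ge1Dx _); rewrite lerD2l lerN2 -lee_fin fineK//.
exact: fin_num_measure.
Qed.

(** * The cube *)

Section cube.
Context {R : realType} (n : nat).
Implicit Types (b : R) (D : set R).

Definition cube b : set 'rV[R]_n := [set x | forall i, `[- b, b]%classic (x ord0 i)].

Lemma volume_cube_coord b (j : 'I_n) D : 0 <= b -> measurable D ->
  volume ([set x : 'rV[R]_n | D (x ord0 j)] `&` cube b) =
  (lebesgue_measure (D `&` `[(- b)%R, b]) * ((2 * b) ^+ n.-1)%:E)%E.
Proof.
move=> b0 mD.
pose B i := if i == j then D `&` `[- b, b]%classic else `[- b, b]%classic.
have mB i : measurable (B i).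
  by rewrite /B; case: ifP => _ //; apply: measurableI.
transitivity (volume [set x : 'rV[R]_n | forall i, B i (x ord0 i)]).
  congr volume; apply/seteqP; split => [x [Dx cx] i|x h].
    by rewrite /B; case: eqP => [->|_]; [split|]; rewrite //; exact: cx.
  split; first by have := h j; rewrite /B eqxx => -[].
  by move=> i; have := h i; rewrite /B; case: ifP => _ // -[].
rewrite volume_box// (bigD1 j)//= {1}/B eqxx; congr (_ * _)%E.
have itvE : lebesgue_measure (`[- b, b]%classic : set R) = (2 * b)%:E.
  by rewrite lebesgue_measure_cc; [congr EFin; ring|lra].
rewrite (eq_bigr (fun=> (2 * b)%:E)) => [|i ij]; last by rewrite /B (negbTE ij).
rewrite prodEFin; congr EFin; rewrite prodr_const; congr (_ ^+ _).
by rewrite cardC1 card_ord.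
Qed.

End cube.

Section sup_norm_ball.
Context {R : realType} (n : nat).
Hypothesis n0 : (0 < n)%N.

Lemma lpball_pinfty : lpball +oo = cube 1 :> set 'rV[R]_n.
Proof.
apply/seteqP; split => x; rewrite /lpball /lpnorm /cube /=.
  by move=> /bigmax_leP[_ h] i; rewrite in_itv/= -ler_norml h.
move=> h; apply/bigmax_leP; split => // i _.
by have := h i; rewrite in_itv/= -ler_norml.
Qed.

Lemma volume_cube b : 0 <= b -> volume (cube b : set 'rV[R]_n) = ((2 * b) ^+ n)%:E.
Proof.
move=> b0; have := volume_cube_coord (Ordinal n0) b0 (@measurableT _ R).
rewrite (_ : [set x : 'rV[R]_n | _] = setT); last exact/seteqP.
rewrite setTI => ->; rewrite setTI.
rewrite lebesgue_measure_cc; last lra.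
rewrite (_ : b - - b = 2 * b); last by ring.
by rewrite -EFinM -exprS prednK.
Qed.

Lemma normalized_lpball_pinfty : normalized_lpball +oo = cube 2^-1 :> set 'rV[R]_n.
Proof.
rewrite /normalized_lpball lpball_pinfty volume_cube//.
have -> : fine ((2 * 1 : R) ^+ n)%:E `^ n%:R^-1 = 2.
  have n0R : n%:R != 0 :> R by rewrite pnatr_eq0 -lt0n.
  by rewrite /= mulr1 -powR_mulrn// powRKV.
apply/seteqP; split => [_ [x hx <-] i|y hy].
  have := hx i; rewrite /= !in_itv/= mxE => /andP[h1 h2].
  by apply/andP; split; lra.
exists (2 *: y); last by rewrite scalerA mulVf ?scale1r.
move=> i; have := hy i; rewrite /= !in_itv/= mxE => /andP[h1 h2].
by apply/andP; split; lra.
Qed.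

Lemma uniform_cube_coord d (T : measurableType d) (P : probability T R)
    (X : {RV P >-> 'rV[R]_n}) (j : 'I_n) D :
  uniformly_distributed (normalized_lpball +oo) X -> measurable D ->
  P [set w | D (X w ord0 j)] = lebesgue_measure (D `&` `[- 2^-1, 2^-1]).
Proof.
move=> uX mD; have h0 : 0 <= 2^-1 :> R by [].
have := uX _ (measurable_coord_set j mD).
rewrite normalized_lpball_pinfty volume_cube// volume_cube_coord// mulfV//.
by rewrite !expr1n inver oner_eq0 invr1 !mule1.
Qed.

End sup_norm_ball.

(** * Expected maximum of one coordinate *)

Section coordinate_maximum.
Context {R : realType} (n N : nat) d (T : measurableType d) (P : probability T R)
  (X : 'I_N -> {RV P >-> 'rV[R]_n}) (j : 'I_n).
Let Y (i : 'I_N) (w : T) : R := `|X i w ord0 j|.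

Let mY i : measurable_fun setT (Y i).
Proof. exact: measurable_abs_coord. Qed.

Lemma expectation_max_coord_pinfty : (0 < n)%N -> (0 < N)%N ->
  (forall i, uniformly_distributed (normalized_lpball +oo) (X i)) ->
  (((16%:R)^-1 : R)%:E <=
    'E_P[fun w => (\big[Num.max/0]_(i < N) Y i w)%R] <= 1%:E)%E.
Proof.
move=> n0 N0 uX; apply/andP; split.
- rewrite (_ : 16^-1 = 4^-1 * 4^-1 :> R); last by field.
  apply: expectation_max_ge => //.
  pose i0 := Ordinal N0.
  have mS i : measurable [set w | 4^-1 <= Y i w].
    exact: measurable_superlevel.
  apply: (@le_trans _ _ (P [set w | 4^-1 <= Y i0 w])%R).
    have mD := measurable_abs_ge (4^-1 : R).
    rewrite [leRHS](uniform_cube_coord n0 j (uX i0) mD).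
    apply: (@le_trans _ _ (lebesgue_measure (`[4^-1, 2^-1]%classic : set R))).
      by rewrite lebesgue_measure_cc ?lee_fin; lra.
    apply: le_measure; rewrite ?inE//; first exact: measurableI.
    move=> u /=; rewrite !in_itv/= => /andP[h1 h2]; split.
      by rewrite ger0_norm//; lra.
    by apply/andP; split; lra.
  apply: le_measure; rewrite ?inE//.
    by apply: fin_bigcup_measurable => [|i _]; first exact: finite_finset.
  by move=> w hw; exists i0.
- have cube0 (D : set R) i : measurable D -> D `<=` [set u | 1 <= `|u|] ->
      P [set w | D (X i w ord0 j)] = 0%E.
    move=> mD D1; rewrite (uniform_cube_coord n0 j (uX i) mD).
    rewrite (_ : _ `&` _ = set0) ?measure0//.
    apply/seteqP; split => u //= [/D1 /= u1]; rewrite in_itv/= -ler_norml.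
    by lra.
  (* the coordinates are at most 1/2, so t = B = 1 are never reached *)
  have -> : 1 = 1 + N%:R * (1 * 0) :> R by rewrite !mulr0 addr0.
  apply: expectation_max_le => // i.
  + apply: (cube0 [set u | 1 < `|u|] i); last by move=> u /ltW.
    exact: (measurable_strict_superlevel 1 (@normr_measurable R setT)).
  + rewrite (_ : P _ = 0%E)//.
    exact: (cube0 [set u | 1 <= `|u|] i (measurable_abs_ge 1)).
Qed.

End coordinate_maximum.

Section coordinate_maximum_finite.
Context {R : realType} (p : R) (n N : nat) d (T : measurableType d)
  (P : probability T R) (X : 'I_N -> {RV P >-> 'rV[R]_n.+1}) (j : 'I_n.+1).
Let e := expR (1 : R).
Let e0 : 0 < e. Proof. exact: expR_gt0. Qed.
Let Y (i : 'I_N) (w : T) : R := `|X i w ord0 j|.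
Let L : R := ln N%:R.
Hypothesis p1 : 1 <= p.
Hypothesis n0 : (0 < n)%N.
Hypothesis nN : (n.+1 <= N)%N.
Hypothesis uX : forall i, uniformly_distributed (normalized_lpball p%:E) (X i).
Let N2 : (2 <= N)%N. Proof. by rewrite (leq_trans _ nN). Qed.
Let N0 : 0 < N%:R :> R. Proof. by rewrite ltr0n (leq_trans _ N2). Qed.
Let expRL : expR L = N%:R. Proof. by rewrite lnK. Qed.

Let L_ge : 2^-1 <= L.
Proof.
rewrite -ler_expR expRL; apply: (@le_trans _ _ 2); last by rewrite ler_nat.
have h := expR_ge1Dx (- 2^-1 : R).
rewrite -[leLHS]invrK -expRN -[leRHS]invrK lef_pV2 ?posrE ?expR_gt0//.
by apply: le_trans h; lra.
Qed.

Let mY i : measurable_fun setT (Y i).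
Proof. exact: measurable_abs_coord. Qed.

Lemma expectation_max_coord_le :
  ('E_P[fun w => (\big[Num.max/0]_(i < N) Y i w)%R] <=
   (5 * e * L `^ p^-1)%:E)%E.
Proof.
have [r [rge rle KE]] := normalized_lpball_radius n p1.
have uX' i : uniformly_distributed (pball p (r^-1 `^ p)) (X i) by rewrite -KE.
have L0 : 0 <= L by apply: le_trans L_ge.
set m : R := n.+1%:R.
have hL := half_le_powRV p1 L_ge.
have t0 : 0 <= 3 * e * L `^ p^-1.
  by rewrite mulr_ge0 ?powR_ge0// mulr_ge0// ltW.
have m0 : 0 <= m by exact: ler0n.
apply: (le_trans (expectation_max_le mY t0 m0
  (fun i => uniform_coord_bounded p1 n0 rge j (uX' i))
  (fun i => uniform_coord_tail_le p1 n0 rge j (uX' i) L0))).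
rewrite lee_fin.
have mN : m / N%:R <= 1 by rewrite ler_pdivrMr// mul1r ler_nat.
have mN0 : 0 <= m / N%:R by rewrite divr_ge0.
have -> : N%:R * (m * (e * m * expR (- (3 * L)))) = e * (m / N%:R) ^+ 2.
  by rewrite expRN expRM_natl expRL; field; rewrite lt0r_neq0.
have h1 : (m / N%:R) ^+ 2 <= 1 by rewrite expr_le1.
have h2 : e * (m / N%:R) ^+ 2 <= e by rewrite -[leRHS]mulr1 ler_wpM2l// ltW.
have h3 : e * 2^-1 <= e * L `^ p^-1 by rewrite ler_wpM2l// ltW.
lra.
Qed.

Lemma expectation_max_coord_ge :
  mutually_independent X -> N%:R <= expR (2^-1 * n.+1%:R) :> R ->
  (((1 - expR (- (32 * e ^+ 5)^-1)) / (8 * e ^+ 3) * L `^ p^-1)%:E <=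
   'E_P[fun w => (\big[Num.max/0]_(i < N) Y i w)%R])%E.
Proof.
move=> iX hN.
have [r [rge rle KE]] := normalized_lpball_radius n p1.
have uX' i : uniformly_distributed (pball p (r^-1 `^ p)) (X i) by rewrite -KE.
set m : R := n.+1%:R.
have Lm : 2 * L <= m.
  have : L <= 2^-1 * m by rewrite -ler_expR expRL.
  by lra.
pose t := L `^ p^-1 / (8 * e ^+ 3).
have e30 : 0 < e ^+ 3 by rewrite exprn_gt0.
have t0 : 0 <= t by rewrite divr_ge0 ?powR_ge0// mulr_ge0// ltW.
have tail i : ((expR (- L) / (32 * e ^+ 5))%:E <=
    P (X i @^-1` [set x | (t <= `|x ord0 j|)%R]))%E.
  exact: (uniform_coord_tail_ge p1 n0 rge rle j (uX' i) L_ge Lm).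
have mD : measurable [set x : 'rV[R]_n.+1 | t <= `|x ord0 j|].
  exact: (measurable_coord_set j (measurable_abs_ge t)).
have := independent_union_ge iX mD tail.
have -> : N%:R * (expR (- L) / (32 * e ^+ 5)) = (32 * e ^+ 5)^-1.
  by rewrite expRN expRL mulrA mulfV ?mul1r// lt0r_neq0.
move=> /(expectation_max_ge mY t0); apply: le_trans.
by rewrite lee_fin /t le_eqVlt; apply/orP; left; apply/eqP; ring.
Qed.

End coordinate_maximum_finite.

(** * Support functions of symmetric hulls *)

Lemma dotprod_delta (R : realType) n (x : 'rV[R]_n) (j : 'I_n) :
  dotprod x (delta_mx ord0 j) = x ord0 j.
Proof.
rewrite /dotprod (bigD1 j)//= mxE !eqxx mulr1 big1 ?addr0// => i ij.
by rewrite mxE (negbTE ij) andbF mulr0.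
Qed.

(** The half-space where the functional is at most the maximum is convex and
    contains the generators, hence the hull; the maximum is reached at a
    generator. *)
Lemma support_function_symmetric_hull (R : realType) (n N : nat)
  (x : 'I_N -> 'rV[R]_n) (theta : 'rV[R]_n) : (0 < N)%N ->
  support_function (symmetric_hull x) theta =
  \big[Num.max/0]_(i < N) `|dotprod (x i) theta|.
Proof.
move=> N0.
set M := \big[_/_]_(_ < _) _.
have M0 : 0 <= M by rewrite /M; apply/bigmax_geP; left.
have dN y : dotprod (- y) theta = - dotprod y theta.
  rewrite /dotprod -sumrN; apply: eq_bigr => i _; by rewrite mxE mulNr.
have hullM y : symmetric_hull x y -> dotprod y theta <= M.
  move=> /(_ [set y | dotprod y theta <= M]); apply.
  split=> [a b t|y' /= [[i _ <-]|[i _ <-]]].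
  - rewrite !inE /= => aM bM.
    have -> : dotprod (conv t a b : 'rV[R]_n) theta = 
       t%:num * dotprod a theta + (1 - t%:num) * dotprod b theta.
      rewrite /dotprod !mulr_sumr -big_split; apply: eq_bigr => i _ /=.
      by rewrite /conv /= !mxE mulrDl !mulrA.
    have t0 : 0 <= t%:num by [].
    have t1 : 0 <= 1 - t%:num :> R by rewrite subr_ge0.
    have := ler_wpM2l t0 aM; have := ler_wpM2l t1 bM; lra.
  - apply: le_trans (ler_norm _) _.
    exact: (le_bigmax_cond _ (fun i => `|dotprod (x i) theta|)).
  - rewrite dN; apply: le_trans (ler_norm _) _; rewrite normrN.
    exact: (le_bigmax_cond _ (fun i => `|dotprod (x i) theta|)).
have sub y : (range x `|` range (fun i => - x i)) y -> symmetric_hull x y.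
  exact: sub_smallest.
apply/eqP; rewrite eq_le; apply/andP; split.
- apply: ge_sup; last by move=> _ [y hy <-]; exact: hullM.
  exists (dotprod (x (Ordinal N0)) theta); exists (x (Ordinal N0)) => //.
  by apply: sub; left; exists (Ordinal N0).
- have ub : has_ubound [set dotprod y theta | y in symmetric_hull x].
    by exists M => _ [y hy <-]; exact: hullM.
  have key i : `|dotprod (x i) theta| <= support_function (symmetric_hull x) theta.
    rewrite ler_norml -[X in X <= _ <= _]opprK lerNl opprK -dN; apply/andP; split.
      apply: ub_le_sup => //; exists (- x i) => //; apply: sub; right; by exists i.
    by apply: ub_le_sup => //; exists (x i) => //; apply: sub; left; exists i.
  apply/bigmax_leP; split => //; exact: le_trans (key (Ordinal N0)).
Qed.

Theorem theorem1p1 (R : realType) :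
  exists c' c1 c2 : R, [/\ 0 < c', 0 < c1, 0 < c2 &
    forall (p : \bar R) (n N : nat),
      (1 <= p)%E -> (0 < n)%N -> (n <= N)%N ->
      N%:R <= expR (c' * n%:R) ->
    forall (d : measure_display) (T : measurableType d) (P : probability T R)
      (X : 'I_N -> {RV P >-> 'rV[R]_n}),
      mutually_independent X ->
      (forall i, uniformly_distributed (normalized_lpball p) (X i)) ->
    forall j : 'I_n,
      let e : 'rV[R]_n := delta_mx ord0 j in
      let E1 := ('E_P[fun w => support_function
                   (symmetric_hull (fun i => X i w)) e])%E in
      let E2 := ('E_P[fun w =>
                   (\big[Num.max/0]_(i < N) `|dotprod (X i w) e|)%R])%E in
      [/\ ((c1 * ln N%:R `^ exponent_inv p)%:E <= E1)%E,
          E1 = E2 &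
          (1 < N)%N \/ p = +oo%E ->
          (E2 <= (c2 * ln N%:R `^ exponent_inv p)%:E)%E]].
Proof.
pose e := expR (1 : R).
have e2 : 2 <= e by have := expR_ge1Dx (1 : R); rewrite -/e; lra.
have e0 : 0 < e by lra.
have e30 : 8 <= e ^+ 3.
  by apply: (@le_trans _ _ (2 ^+ 3)); [lra|rewrite lerXn2r ?nnegrE//; lra].
pose k := expR (- (32 * e ^+ 5)^-1).
have k1 : k < 1 by rewrite expR_lt1 oppr_lt0 invr_gt0 mulr_gt0// exprn_gt0.
have k0 : 0 < k by exact: expR_gt0.
(* with c' = 1/2, log N <= n / 2 is the hypothesis of the lower tail estimate *)
exists 2^-1, ((1 - k) / (8 * e ^+ 3)), (5 * e); split.
- by [].
- by rewrite divr_gt0 ?subr_gt0// mulr_gt0//; lra.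
- lra.
move=> p n N p1 n0 nN hN d T P X iX uX j e' E1 E2.
have N0 : (0 < N)%N by rewrite (leq_trans n0).
have E12 : E1 = E2.
  rewrite /E1 /E2; congr expectation; apply/funext => w.
  exact: support_function_symmetric_hull.
have E2E : E2 = ('E_P[fun w => (\big[Num.max/0]_(i < N) `|X i w ord0 j|)%R])%E.
  rewrite /E2; congr expectation; apply/funext => w.
  by apply: eq_bigr => i _; rewrite dotprod_delta.
rewrite E12 E2E; clear E1 E2 E12 E2E e'.
case: p p1 uX => [p| |//] p1 uX.
- rewrite lee_fin in p1.
  have [N1|N2] := leqP N 1.
    split=> [|//|]; last by case.
    have -> : N%:R = 1 :> R.
      by rewrite (_ : N = 1%N)//; apply/eqP; rewrite eqn_leq N1.
    rewrite ln1 /= powR0 ?invr_neq0 ?lt0r_neq0//; last exact: lt_le_trans p1.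
    rewrite mulr0 unlock; apply: integral_ge0 => w _; rewrite lee_fin.
    by apply/bigmax_geP; left.
  case: n n0 nN hN X iX uX j => // n _ nN hN X iX uX j.
  (* e^(1/2) < 2 <= N excludes dimension one *)
  have n0 : (0 < n)%N.
    rewrite lt0n; apply/eqP => nE; move: hN; rewrite nE mulr1 leNgt => /negP; apply.
    have h : 1 - 2^-1 < expR (- 2^-1 : R) by apply: expR_gt1Dx; lra.
    apply: (@lt_le_trans _ _ 2); last by rewrite ler_nat.
    rewrite -[ltLHS]invrK -expRN -[ltRHS]invrK ltf_pV2 ?posrE ?expR_gt0//.
    by apply: le_lt_trans h; lra.
  split=> [|//|_].
    exact: expectation_max_coord_ge.
  exact: expectation_max_coord_le.
- have /andP[lo hi] := expectation_max_coord_pinfty j n0 N0 uX.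
  split => //=; rewrite powRr0 mulr1.
    apply: le_trans lo; rewrite lee_fin ler_pdivrMr; lra.
  by move=> _; apply: (le_trans hi); rewrite lee_fin; lra.
Qed.
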